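(* Let $\mathcal{H}$ be a Hilbert space, let $t\mapsto H(t)$ be a strongly continuous map from $\mathbb{R}$ into the bounded self-adjoint operators on $\mathcal{H}$, let $P$ be an orthogonal projection on $\mathcal{H}$ and $Q=1-P$. Fix $t_0\in\mathbb{R}$. Let $T$ be a tree with $|T|>1$ and write $T=T_1\vee T_2$. Then, for all $t$: (a) if $T_1=|$ (so $T_2\neq |$), $\Omega_T(t,t_0)=-\imath\int_{t_0}^t \mathrm{d}s\, Q H(s)\,\Omega_{T_2}(s,t_0)$; (b) if $T_2=|$ (so $T_1\neq |$), $\Omega_T(t,t_0)=\imath\int_{t_0}^t \mathrm{d}s\, \Omega_{T_1}(s,t_0) H(s) P$; (c) if $T_1\neq |$ and $T_2\neq |$, $\Omega_T(t,t_0)=\imath\int_{t_0}^t \mathrm{d}s\, \Omega_{T_1}(s,t_0) H(s)\,\Omega_{T_2}(s,t_0)$.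
   Context: Trees: let $|$ denote the empty tree. Define sets $Y_n$ recursively by $Y_0=\{|\}$ and, for $n>0$, $Y_n=\{T_1\vee T_2: T_1\in Y_k,\ T_2\in Y_{n-k-1},\ k=0,\dots,n-1\}$, where $T_1\vee T_2$ is a formal grafting (an ordered pair, with $T_1\vee T_2=T_1'\vee T_2'$ iff $T_1=T_1'$ and $T_2=T_2'$). A tree is an element of some $Y_n$, and $|T|:=n$ for $T\in Y_n$ (the number of vertices). Every tree $T\neq|$ is uniquely of the form $T_1\vee T_2$, and $|T_1\vee T_2|=|T_1|+|T_2|+1$. For a tuple $I$ of distinct integers define $\phi(I)$ recursively by $\phi(\emptyset)=|$ and otherwise $\phi(I)=\phi(I_1)\vee\phi(I_2)$, where $I=I_1\cdot(\min I)\cdot I_2$ ($\cdot$ is concatenation of tuples; $I_1$ or $I_2$ may be empty). For a tree $T$ with $|T|=n\ge1$ let $S_T=\{\sigma\in\mathcal{S}_n:\phi(\sigma(1),\dots,\sigma(n))=T\}$, $\mathcal{S}_n$ the symmetric group. For $\sigma\in\mathcal{S}_n$ define operator-valued factors $X^\sigma_p(s)$, $p=1,\dots,n$: if $n=1$, $X^\sigma_1(s)=-\imath QH(s)P$. If $n>1$: $X^\sigma_1(s)=-\imath QH(s)$; for $1<p<n$, $X^\sigma_p(s)=-\imath QH(s)$ if $\sigma(p)>\sigma(p-1)$ and $X^\sigma_p(s)=\imath PH(s)$ if $\sigma(p)<\sigma(p-1)$; $X^\sigma_n(s)=-\imath QH(s)P$ if $\sigma(n)>\sigma(n-1)$ and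 $X^\sigma_n(s)=\imath PH(s)P$ if $\sigma(n)<\sigma(n-1)$. Define $\Omega_|(t,t_0)=P$ and, for a tree $T$ with $|T|=n\ge1$, $\Omega_T(t,t_0)=\sum_{\sigma\in S_T}\int_{t_0}^{t}\mathrm{d}t_1\int_{t_0}^{t_1}\mathrm{d}t_2\cdots\int_{t_0}^{t_{n-1}}\mathrm{d}t_n\, X^\sigma_1(t_{\sigma(1)})X^\sigma_2(t_{\sigma(2)})\cdots X^\sigma_n(t_{\sigma(n)})$. *)

(* Defs.v *)
From Stdlib Require Import Reals.
From Coquelicot Require Import Coquelicot.
From mathcomp Require Import ssreflect ssrbool ssrfun eqtype ssrnat seq.

Set Implicit Arguments.
Unset Strict Implicit.

Definition is_complex_hilbert (V : CompleteNormedModule R_AbsRing)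
  (cs : C -> V -> V) (ip : V -> V -> C) : Prop :=
  (forall (r : R) (x : V), cs (RtoC r) x = scal r x) /\
  (forall (a b : C) (x : V), cs a (cs b x) = cs (Cmult a b) x) /\
  (forall (a b : C) (x : V), cs (Cplus a b) x = plus (cs a x) (cs b x)) /\
  (forall (a : C) (x y : V), cs a (plus x y) = plus (cs a x) (cs a y)) /\
  (forall x y z : V, ip (plus x y) z = Cplus (ip x z) (ip y z)) /\
  (forall (a : C) (x y : V), ip (cs a x) y = Cmult a (ip x y)) /\
  (forall x y : V, ip y x = Cconj (ip x y)) /\
  (forall x : V, 0 <= Re (ip x x))%R /\
  (forall x : V, ip x x = RtoC 0 -> x = zero) /\
  (forall x : V, norm x = sqrt (Re (ip x x))).

Section Ops.
Variables (V : CompleteNormedModule R_AbsRing) (cs : C -> V -> V)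
  (ip : V -> V -> C).

Definition bounded_op (A : V -> V) : Prop :=
  (forall x y : V, A (plus x y) = plus (A x) (A y)) /\
  (forall (a : C) (x : V), A (cs a x) = cs a (A x)) /\
  (exists M : R, forall x : V, (norm (A x) <= M * norm x)%R).

Definition self_adjoint (A : V -> V) : Prop :=
  forall x y : V, ip (A x) y = ip x (A y).

Definition bounded_self_adjoint (A : V -> V) : Prop :=
  bounded_op A /\ self_adjoint A.

Definition orth_projection (P : V -> V) : Prop :=
  bounded_self_adjoint P /\ (forall x : V, P (P x) = P x).

Definition strongly_continuous (H : R -> V -> V) : Prop :=
  forall (x : V) (t : R), continuous (fun s => H s x) t.

End Ops.

Inductive tree : Type :=
| Leaf : tree
| Node : tree -> tree -> tree.

Fixpoint tree_eqb (T T' : tree) : bool :=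
  match T, T' with
  | Leaf, Leaf => true
  | Node A B, Node A' B' => tree_eqb A A' && tree_eqb B B'
  | _, _ => false
  end.

Fixpoint tsize (T : tree) : nat :=
  match T with
  | Leaf => 0
  | Node T1 T2 => (tsize T1 + tsize T2).+1
  end.

(* phi on tuples (lists) of distinct naturals: split at the minimum.
   The fuel argument is the length of the list (strictly decreasing). *)
Fixpoint phi_fuel (k : nat) (I : seq nat) : tree :=
  match k, I with
  | 0, _ => Leaf
  | _, [::] => Leaf
  | k'.+1, i :: I' =>
      let m := foldr minn i I' in
      let j := index m I in
      Node (phi_fuel k' (take j I)) (phi_fuel k' (drop j.+1 I))
  end.

Definition phi (I : seq nat) : tree := phi_fuel (size I) I.

(* A permutation sigma of S_n is represented by the list
   [:: sigma(1); ...; sigma(n)], so sigma(p) = nth 0 s (p-1).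
   S_T as a list: all permutations of [1..n] with phi = T. *)
Definition S_T (T : tree) : seq (seq nat) :=
  [seq s <- permutations (iota 1 (tsize T)) | tree_eqb (phi s) T].

Section Omega.
Variables (V : CompleteNormedModule R_AbsRing) (cs : C -> V -> V)
  (H : R -> V -> V) (P : V -> V).

Definition Qop (x : V) : V := minus x (P x).

Definition mI : C := Ci.
Definition mmI : C := Copp Ci.

Definition Xfactor (n : nat) (sg : seq nat) (p : nat) (t : R) (x : V) : V :=
  let up := (nth 0%N sg (p - 2)%N < nth 0%N sg (p - 1)%N)%N in
  if (n == 1)%N then cs mmI (Qop (H t (P x)))
  else if (p == 1)%N then cs mmI (Qop (H t x))
  else if (p < n)%N then
    (if up then cs mmI (Qop (H t x)) else cs mI (P (H t x)))
  else
    (if up then cs mmI (Qop (H t (P x))) else cs mI (P (H t (P x)))).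

(* product X_1(t_{sigma 1}) ... X_n(t_{sigma n}) applied to x,
   where the times are t_j = nth 0 env (j-1) *)
Definition Xprod (n : nat) (sg : seq nat) (env : seq R) (x : V) : V :=
  foldr (fun p acc => Xfactor n sg p (nth 0%R env (nth 0%N sg (p - 1) - 1)%N) acc)
        x (iota 1 n).

(* iterated integral
   int_{t0}^{u} dt_1 int_{t0}^{t_1} dt_2 ... int_{t0}^{t_{k-1}} dt_k F(t_1..t_k),
   the previously bound times being stored in env *)
Fixpoint iint (t0 : R) (k : nat) (u : R) (env : seq R) (F : seq R -> V) : V :=
  match k with
  | 0 => F env
  | k'.+1 => RInt (fun s => iint t0 k' s (rcons env s) F) t0 u
  end.

Definition vsum (l : seq V) : V := foldr plus zero l.

Definition Omega (T : tree) (t t0 : R) (x : V) : V :=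
  match T with
  | Leaf => P x
  | Node _ _ =>
      vsum [seq iint t0 (tsize T) t [::] (fun env => Xprod (tsize T) sg env x)
           | sg <- S_T T]
  end.

End Omega.

(* Main.v *)
(* In the factor product of a permutation s with tree T, position p carries i P H
   if the vertex p of T (in symmetric order) has a nonempty left subtree, and
   -i Q H otherwise: the predecessor of a vertex is a descendant, hence carries a
   larger label, exactly when the left subtree is nonempty.  So the product
   depends on T only, and summing over S_T means integrating one product over
   all times that decrease from the root of T to its leaves.

   Let W_T(u) be the operator with W_| = 1 and
   W_(A v B)(u) = int_t0^u W_A(s) K_A H(s) W_B(s) ds, where K_A = -i Q if A = |
   and i P otherwise.  The theorem follows from Omega_T = W_T P.  To see this,
   bind the times one after the other.  When t_1, ..., t_k are bound, the
   labels 1, ..., k occupy some vertices, and the unvisited subtrees T_0, ..., T_k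
   between them still contribute the factors W_(T_i)(u).  By the product rule, the
   derivative of the whole product in u is the sum over i of the products in which
   the root of T_i receives the label k + 1; this is one integration step of the
   iterated integral.  Strong continuity of H gives the local bounds that the
   product rule needs by the uniform boundedness principle. *)
Require Import Defs.
From Stdlib Require Import Reals.
From Coquelicot Require Import Coquelicot.
From Stdlib Require Import Lra Lia Classical IndefiniteDescription.
From HB Require Import structures.
From mathcomp Require ssreflect ssrbool ssrfun eqtype ssrnat seq path zify.

(* A module, so that ssrnat's notations do not reach the theorem. *)
Module TreeExpansion.
Import mathcomp.boot.ssreflect.
Local Open Scope R_scope.

(** * Uniform boundedness *)

Section UniformBoundedness.
Context {V : CompleteNormedModule R_AbsRing}.
Implicit Types x y z : V.

(* Coquelicot's lemmas at the structures inferred for [V]: terms that differ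
   only in the chosen structure are not identified by [rewrite] and [lra]. *)

Lemma vnorm_zero : norm (zero : V) = 0.
Proof. exact (@norm_zero R_AbsRing V). Qed.
Lemma vplus_comm x y : plus x y = plus y x.
Proof. exact (@plus_comm V x y). Qed.
Lemma vplus_assoc x y z : plus x (plus y z) = plus (plus x y) z.
Proof. exact (@plus_assoc V x y z). Qed.
Lemma vplus_zero_r x : plus x zero = x.
Proof. exact (@plus_zero_r V x). Qed.
Lemma vplus_zero_l x : plus zero x = x.
Proof. exact (@plus_zero_l V x). Qed.
Lemma vplus_opp_r x : plus x (opp x) = zero.
Proof. exact (@plus_opp_r V x). Qed.
Lemma vplus_opp_l x : plus (opp x) x = zero.
Proof. exact (@plus_opp_l V x). Qed.
Lemma vopp_plus x y : opp (plus x y) = plus (opp x) (opp y).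
Proof. exact (@opp_plus V x y). Qed.
Lemma vopp_opp x : opp (opp x) = x.
Proof. exact (@opp_opp V x). Qed.
Lemma vminus_self x : minus x x = zero.
Proof. exact (@minus_eq_zero V x). Qed.
Lemma vminus_trans z x y : minus x y = plus (minus x z) (minus z y).
Proof. exact (@minus_trans V z x y). Qed.
Lemma vopp_minus x y : opp (minus x y) = minus y x.
Proof. exact (@opp_minus V x y). Qed.
Lemma vnorm_triangle x y : norm (plus x y) <= norm x + norm y.
Proof. exact (@norm_triangle R_AbsRing V x y). Qed.
Lemma vnorm_opp x : norm (opp x) = norm x.
Proof. exact (@norm_opp R_AbsRing V x). Qed.
Lemma vnorm_minus_sym x y : norm (minus x y) = norm (minus y x).
Proof. now rewrite -vnorm_opp vopp_minus. Qed.
Lemma vnorm_minus_le x y : norm (minus x y) <= norm x + norm y.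
Proof. rewrite -(vnorm_opp y). apply vnorm_triangle. Qed.
Lemma vnorm_dist_triangle z x y :
  norm (minus x y) <= norm (minus x z) + norm (minus z y).
Proof. rewrite (vminus_trans z). apply vnorm_triangle. Qed.
Lemma vnorm_le_dist x y : norm x <= norm y + norm (minus x y).
Proof.
replace x with (plus y (minus x y)) at 1; [apply vnorm_triangle|].
unfold minus. now rewrite vplus_comm -vplus_assoc vplus_opp_l vplus_zero_r.
Qed.

Lemma vscal_one x : scal 1 x = x.
Proof. exact (@scal_one _ V x). Qed.
Lemma vscal_assoc (a b : R) x : scal a (scal b x) = scal (a * b) x.
Proof. exact (@scal_assoc _ V a b x). Qed.
Lemma vscal_plus_l (a b : R) x : scal (a + b) x = plus (scal a x) (scal b x).
Proof. exact (@scal_distr_r _ V a b x). Qed.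
Lemma vscal_plus_r (a : R) x y : scal a (plus x y) = plus (scal a x) (scal a y).
Proof. exact (@scal_distr_l _ V a x y). Qed.
Lemma vscal_zero_l x : scal 0 x = zero.
Proof. exact (@scal_zero_l _ V x). Qed.
Lemma vscal_opp_one x : scal (-1) x = opp x.
Proof. exact (@scal_opp_one _ V x). Qed.

(** The reverse inequality is [norm_scal] again, for the scalar [/ r] and the vector [scal r x]. *)
Lemma vnorm_scal (r : R) x : norm (scal r x) = Rabs r * norm x.
Proof.
apply Rle_antisym; [exact (norm_scal r x)|].
destruct (Req_dec r 0) as [->|Hr].
- rewrite Rabs_R0 Rmult_0_l. apply norm_ge_0.
- assert (H : norm (scal (/ r) (scal r x)) <= Rabs (/ r) * norm (scal r x))
    by exact (norm_scal (/ r) (scal r x)).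
  rewrite vscal_assoc (Rinv_l _ Hr) vscal_one Rabs_inv in H.
  assert (Hp : 0 < Rabs r) by now apply Rabs_pos_lt.
  apply Rmult_le_reg_l with (/ Rabs r); [now apply Rinv_0_lt_compat|].
  rewrite -Rmult_assoc (Rinv_l _ (Rgt_not_eq _ _ Hp)) Rmult_1_l. exact H.
Qed.

Lemma ball_of_vnorm x y e : norm (minus y x) < e -> ball x e y.
Proof. exact (@norm_compat1 R_AbsRing V x y e). Qed.

(** Balls of the uniform structure and balls of the norm agree only up to [norm_factor], so the
    radius is divided by it. *)
Lemma vnorm_of_ball x (e : posreal) y :
  ball x (e / @norm_factor R_AbsRing V) y -> norm (minus y x) < e.
Proof.
intros H.
assert (Hf : 0 < @norm_factor R_AbsRing V) by apply norm_factor_gt_0.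
assert (He : 0 < e / @norm_factor R_AbsRing V)
  by (apply Rdiv_lt_0_compat; [apply cond_pos|exact Hf]).
replace (pos e) with (@norm_factor R_AbsRing V * mkposreal _ He)
  by (simpl; field; lra).
exact (@norm_compat2 R_AbsRing V x y (mkposreal _ He) H).
Qed.

(** The constant is $\sum_{k\ge0}3^{-k}=3/2$; the factor $1-3^{-k}$ in the proof makes the partial
    sums exact, so that the induction closes. *)
Lemma geometric_cauchy_limit (x : nat -> V) :
  (forall n, norm (minus (x (S n)) (x n)) <= (1/3)^n) ->
  exists l : V, forall n, norm (minus l (x n)) <= 3/2 * (1/3)^n.
Proof.
intros Hx.
assert (Hk : forall n k, norm (minus (x (n + k)%nat) (x n)) <= 3/2 * (1/3)^n * (1 - (1/3)^k)).
{ intros n k; induction k as [|k IH].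
  - rewrite Nat.add_0_r vminus_self vnorm_zero; simpl; lra.
  - rewrite Nat.add_succ_r.
    rewrite (vminus_trans (x (n+k)%nat)).
    eapply Rle_trans; [apply vnorm_triangle|].
    specialize (Hx (n+k)%nat). rewrite pow_add in Hx. simpl.
    lra. }
assert (Hp : forall n, 0 < (1/3)^n) by (intros; apply pow_lt; lra).
assert (Hb : forall n k, norm (minus (x (n + k)%nat) (x n)) <= 3/2 * (1/3)^n).
{ intros n k. eapply Rle_trans; [apply Hk|].
  generalize (Hp n) (Hp k); nra. }
set (F := filtermap x eventually).
assert (HF : ProperFilter F) by (apply filtermap_proper_filter, eventually_filter).
assert (Hc : cauchy F).
{ intros eps.
  destruct (pow_lt_1_zero (1/3)) with (y := eps / 2) as [N HN].
  - rewrite Rabs_pos_eq; lra.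
  - generalize (cond_pos eps); lra.
  - exists (x N). exists N. intros m Hm.
    apply ball_of_vnorm.
    replace m with (N + (m - N))%nat by lia.
    eapply Rle_lt_trans; [apply Hb|].
    specialize (HN N (le_n _)). rewrite Rabs_pos_eq in HN; [|apply Rlt_le, Hp].
    generalize (cond_pos eps); lra. }
exists (lim F). intros n.
apply le_epsilon. intros e He.
assert (He' : 0 < e / @norm_factor R_AbsRing V)
  by (apply Rdiv_lt_0_compat; [exact He|apply norm_factor_gt_0]).
destruct (complete_cauchy F HF Hc (mkposreal _ He')) as [N HN].
specialize (HN (n + N)%nat ltac:(lia)).
apply (vnorm_of_ball _ (mkposreal e He)) in HN. simpl in HN.
rewrite (vminus_trans (x (n + N)%nat)).
eapply Rle_trans; [apply vnorm_triangle|].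
specialize (Hb n N). rewrite -(vnorm_opp (minus (lim F) _)) vopp_minus. lra.
Qed.

Definition real_linear (T : V -> V) : Prop :=
  (forall x y, T (plus x y) = plus (T x) (T y)) /\
  (forall (r : R) x, T (scal r x) = scal r (T x)).

Lemma real_linear_zero T : real_linear T -> T zero = zero.
Proof. intros [_ Hs]. rewrite -{1}(vscal_zero_l zero) Hs. apply vscal_zero_l. Qed.

Lemma real_linear_opp T x : real_linear T -> T (opp x) = opp (T x).
Proof. intros [_ Hs]. rewrite -vscal_opp_one Hs. apply vscal_opp_one. Qed.

Lemma real_linear_minus T x y :
  real_linear T -> T (minus x y) = minus (T x) (T y).
Proof.
intros HT. unfold minus. rewrite (proj1 HT). now rewrite real_linear_opp.
Qed.

(** A substitute for the operator norm. The bound $M$ is multiplied by $2/3$ as long as the result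
    is still a bound; this must stop before the bound falls below $N$. *)
Lemma near_optimal_bound (T : V -> V) (N M : R) :
  0 < N -> (forall x, norm (T x) <= M * norm x) ->
  ~ (forall x, norm (T x) <= N * norm x) ->
  exists K, N <= K /\ (forall x, norm (T x) <= K * norm x) /\
    exists e, norm (T e) > 2/3 * K * norm e.
Proof.
intros HN HM HnN.
destruct (Rle_or_lt M N) as [Hl|Hl].
{ exfalso; apply HnN; intros x; eapply Rle_trans; [apply HM|].
  apply Rmult_le_compat_r; [apply norm_ge_0|exact Hl]. }
destruct (pow_lt_1_zero (2/3)) with (y := N / M) as [k Hk].
- rewrite Rabs_pos_eq; lra.
- apply Rdiv_lt_0_compat; lra.
- specialize (Hk k (le_n _)).
  rewrite Rabs_pos_eq in Hk; [|apply pow_le; lra].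
  assert (Hk' : (2/3)^k * M <= N).
  { apply Rlt_le. apply Rmult_lt_compat_r with (r := M) in Hk; [|lra].
    replace (N / M * M) with N in Hk by (field; lra). exact Hk. }
  clear Hk Hl. revert M HM Hk'. induction k as [|k IH]; intros M HM Hk.
  + exfalso; apply HnN; intros x; eapply Rle_trans; [apply HM|].
    apply Rmult_le_compat_r; [apply norm_ge_0|simpl in Hk; lra].
  + destruct (classic (forall x, norm (T x) <= 2/3 * M * norm x)) as [H|H].
    * apply (IH _ H). simpl in Hk. lra.
    * exists M. split; [|split; [exact HM|]].
      -- destruct (Rle_or_lt N M) as [|Hl]; [assumption|].
         exfalso; apply HnN; intros x; eapply Rle_trans; [apply HM|].
         apply Rmult_le_compat_r; [apply norm_ge_0|lra].
      -- apply not_all_ex_not in H. destruct H as [e He]. exists e. lra.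
Qed.

(** If $v$ is [e] rescaled to norm $r$, then $T(x+v)-T(x-v)=2Tv$, so one of $x\pm v$ has an image at
    least as long as $Tv$ or $cr$ requires. *)
Lemma large_value_in_ball (T : V -> V) (c r : R) (x : V) :
  real_linear T -> 0 <= c -> 0 < r ->
  (exists e, norm (T e) > c * norm e) ->
  exists y, norm (minus y x) <= r /\ c * r <= norm (T y).
Proof.
intros HT Hc Hr [e He].
assert (Hne : 0 < norm e).
{ destruct (norm_ge_0 e) as [H|H]; [exact H|].
  symmetry in H. apply norm_eq_zero in H. subst e.
  rewrite (real_linear_zero _ HT) vnorm_zero in He. lra. }
set (v := scal (r / norm e) e).
assert (Hrn : 0 <= r / norm e) by (apply Rlt_le, Rdiv_lt_0_compat; assumption).
assert (Hv : norm v = r).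
{ unfold v. rewrite vnorm_scal (Rabs_pos_eq _ Hrn). field; lra. }
assert (HTv : c * r <= norm (T v)).
{ unfold v. rewrite (proj2 HT) vnorm_scal (Rabs_pos_eq _ Hrn).
  replace (c * r) with (r / norm e * (c * norm e)) by (field; lra).
  apply Rmult_le_compat_l; lra. }
destruct (Rle_or_lt (c * r) (norm (T (plus x v)))) as [H1|H1].
- exists (plus x v). split; [|exact H1].
  unfold minus. rewrite (vplus_comm x) -vplus_assoc vplus_opp_r vplus_zero_r. lra.
- exists (minus x v). split.
  + unfold minus. rewrite (vplus_comm x) -vplus_assoc vplus_opp_r vplus_zero_r.
    rewrite vnorm_opp. lra.
  + assert (H2 : norm (minus (T (plus x v)) (T (minus x v))) = 2 * norm (T v)).
    { rewrite -(real_linear_minus _ _ _ HT).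
      replace (minus (plus x v) (minus x v)) with (scal 2 v).
      - rewrite (proj2 HT) vnorm_scal Rabs_pos_eq; lra.
      - unfold minus. rewrite vopp_plus vopp_opp.
        rewrite (vplus_comm x v) -vplus_assoc (vplus_assoc x) vplus_opp_r vplus_zero_l.
        replace 2 with (1 + 1) by lra.
        rewrite vscal_plus_l. now rewrite vscal_one. }
    assert (H3 := vnorm_minus_le (T (plus x v)) (T (minus x v))). lra.
Qed.

(* Sokal's gliding hump: the points x_n with |x_{n+1} - x_n| <= 3^-n are chosen
   so that T_n x_{n+1} is large, and the later steps are too short to undo it. *)
Lemma uniform_boundedness (I : Type) (T : I -> V -> V) :
  (forall i, real_linear (T i)) ->
  (forall i, exists M, forall x, norm (T i x) <= M * norm x) ->
  (forall x, exists M, forall i, norm (T i x) <= M) ->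
  exists M, forall i x, norm (T i x) <= M * norm x.
Proof.
intros Hlin Hbd Hpt. apply NNPP. intros Hno.
assert (Hch : forall n : nat, exists p : I * R,
  4^n <= snd p /\ (forall x, norm (T (fst p) x) <= snd p * norm x) /\
  exists e, norm (T (fst p) e) > 2/3 * snd p * norm e).
{ intros n.
  assert (H : exists i, ~ (forall x, norm (T i x) <= 4^n * norm x)).
  { apply not_all_ex_not. intros H. apply Hno. now exists (4^n). }
  destruct H as [i Hi]. destruct (Hbd i) as [M HM].
  destruct (near_optimal_bound (T i) (4^n) M) as [K HK];
    [apply pow_lt; lra|exact HM|exact Hi|].
  now exists (i, K). }
apply functional_choice in Hch. destruct Hch as [p Hp].
assert (Hst : forall q : nat * V, exists y,
  norm (minus y (snd q)) <= (1/3)^(fst q) /\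
  2/3 * snd (p (fst q)) * (1/3)^(fst q) <= norm (T (fst (p (fst q))) y)).
{ intros [n x]. destruct (Hp n) as [H1 [_ H2]]. simpl.
  apply large_value_in_ball; [apply Hlin| | |exact H2].
  - assert (0 < 4^n) by (apply pow_lt; lra). lra.
  - apply pow_lt; lra. }
apply functional_choice in Hst. destruct Hst as [f Hf].
set (x := fix x n := match n with O => zero | S m => f (m, x m) end).
destruct (geometric_cauchy_limit x) as [l Hl].
{ intros n. exact (proj1 (Hf (n, x n))). }
destruct (Hpt l) as [M HM].
(* Let $K\ge4^N$ be the bound of the $N$-th operator and $\epsilon=3^{-N}$. The choice of $x_{N+1}$
   and the estimate of $l-x_{N+1}$ give $\frac23K\epsilon\le M+\frac12K\epsilon$, that is
   $K\epsilon\le6M$, whereas $K\epsilon\ge(4/3)^N\ge6|M|+1$. *)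
destruct (Pow_x_infinity (4/3)) with (b := 6 * Rabs M + 1) as [N HN].
{ rewrite Rabs_pos_eq; lra. }
specialize (HN N (le_n _)). rewrite Rabs_pos_eq in HN; [|apply pow_le; lra].
assert (HfN := proj2 (Hf (N, x N))). change (f (N, x N)) with (x (S N)) in HfN.
cbn [fst snd] in HfN.
destruct (Hp N) as [HK [HKb _]]. set (K := snd (p N)) in *. set (i := fst (p N)) in *.
assert (H1 := HKb (minus l (x (S N)))). rewrite (real_linear_minus _ _ _ (Hlin _)) in H1.
assert (H2 := Hl (S N)). simpl pow in H2.
assert (H3 := HM i).
assert (H4 := vnorm_le_dist (T i (x (S N))) (T i l)).
rewrite vnorm_minus_sym in H4.
assert (HK0 : 0 < 4^N) by (apply pow_lt; lra).
assert (He : 0 < (1/3)^N) by (apply pow_lt; lra).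
assert (H5 : (4/3)^N = 4^N * (1/3)^N) by (rewrite -Rpow_mult_distr; f_equal; lra).
assert (H6 : 4^N * (1/3)^N <= K * (1/3)^N) by (apply Rmult_le_compat_r; lra).
assert (H7 : K * norm (minus l (x (S N))) <= K * (3/2 * (1/3 * (1/3)^N)))
  by (apply Rmult_le_compat_l; lra).
assert (H8 := Rle_abs M).
rewrite H5 in HN. lra.
Qed.
End UniformBoundedness.

(** * Strongly continuous operator families *)

Section VectorCalculus.
Context {V : CompleteNormedModule R_AbsRing}.

Lemma continuous_vnorm {U : UniformSpace} (f : U -> V) (z : U) :
  continuous f z <->
  forall e : posreal, locally z (fun z' => norm (minus (f z') (f z)) < e).
Proof.
split.
- intros Hf e.
  assert (He : 0 < e / @norm_factor R_AbsRing V)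
    by (apply Rdiv_lt_0_compat; [apply cond_pos|apply norm_factor_gt_0]).
  generalize (proj1 (filterlim_locally f (f z)) Hf (mkposreal _ He)).
  apply filter_imp. intros z'. apply vnorm_of_ball.
- intros Hf. apply filterlim_locally. intros e.
  generalize (Hf e). apply filter_imp. intros z'. apply ball_of_vnorm.
Qed.

Lemma is_derive_vnorm (f : R -> V) (s : R) (l : V) :
  is_derive f s l <->
  forall e : posreal, locally s (fun r =>
    norm (minus (minus (f r) (f s)) (scal (r - s) l)) <= e * Rabs (r - s)).
Proof.
split.
- intros [_ Hf]. exact (Hf s (fun P HP => HP)).
- intros Hf. split.
  + apply (@is_linear_scal_l R_AbsRing V l).
  + intros x Hx. apply (is_filter_lim_locally_unique s x) in Hx.
    rewrite -Hx. exact Hf.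
Qed.

Lemma norm_bounded_on_interval (f : R -> V) (a b : R) :
  (forall s, continuous f s) ->
  exists M, forall s, a <= s <= b -> norm (f s) <= M.
Proof.
intros Hf. destruct (Rle_or_lt a b) as [Hab|Hab].
- destruct (continuity_ab_maj (fun s => norm (f s)) a b Hab) as [m [Hm _]].
  + intros c _. apply continuity_pt_filterlim.
    apply (filterlim_comp _ _ _ f norm _ (locally (f c))); [apply Hf|].
    exact (@filterlim_norm R_AbsRing V (f c)).
  + exists (norm (f m)). exact Hm.
- exists 0. intros; lra.
Qed.

Lemma ex_RInt_cont (f : R -> V) (a b : R) :
  (forall s, continuous f s) -> ex_RInt f a b.
Proof. intros Hf. apply ex_RInt_continuous. intros; apply Hf. Qed.

Lemma RInt_derive_cont (f df : R -> V) (a b : R) :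
  (forall s, is_derive f s (df s)) -> (forall s, continuous df s) ->
  RInt df a b = minus (f b) (f a).
Proof.
intros Hf Hdf. apply is_RInt_unique, is_RInt_derive; intros; auto.
Qed.

Lemma is_derive_RInt_cont (f : R -> V) (a s : R) :
  (forall s, continuous f s) -> is_derive (fun u => RInt f a u) s (f s).
Proof.
intros Hf. apply (is_derive_RInt f _ a s); [|apply Hf].
apply filter_forall. intros u. apply RInt_correct, ex_RInt_cont, Hf.
Qed.

Definition bounded_linear (L : V -> V) : Prop :=
  real_linear L /\ exists M, forall x, norm (L x) <= M * norm x.

Lemma bounded_linear_pos_bound (L : V -> V) :
  bounded_linear L -> exists M, 0 < M /\ forall x, norm (L x) <= M * norm x.
Proof.
intros [_ [M HM]]. exists (Rabs M + 1). split; [generalize (Rabs_pos M); lra|].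
intros x. eapply Rle_trans; [apply HM|].
apply Rmult_le_compat_r; [apply norm_ge_0|]. generalize (Rle_abs M); lra.
Qed.

Lemma is_derive_bounded_linear (L : V -> V) (f : R -> V) s l :
  bounded_linear L -> is_derive f s l -> is_derive (fun r => L (f r)) s (L l).
Proof.
intros HL Hf. destruct (bounded_linear_pos_bound L HL) as [M [HM0 HM]].
destruct HL as [HL _].
apply is_derive_vnorm. intros e.
assert (He : 0 < e / M) by (apply Rdiv_lt_0_compat; [apply cond_pos|exact HM0]).
generalize (proj1 (is_derive_vnorm f s l) Hf (mkposreal _ He)).
apply filter_imp. simpl. intros r Hr.
rewrite -(proj2 HL) -!(real_linear_minus _ _ _ HL).
eapply Rle_trans; [apply HM|].
replace (e * Rabs (r - s)) with (M * (e / M * Rabs (r - s))) by (field; lra).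
apply Rmult_le_compat_l; [lra|exact Hr].
Qed.

(** The function $u\mapsto L(\int_a^u f)$ has derivative $L(f(u))$ and vanishes at $a$. *)
Lemma RInt_bounded_linear (L : V -> V) (f : R -> V) (a b : R) :
  bounded_linear L -> (forall s, continuous f s) ->
  RInt (fun s => L (f s)) a b = L (RInt f a b).
Proof.
intros HL Hf.
assert (Hd : forall s, is_derive (fun u => L (RInt f a u)) s (L (f s))).
{ intros s. apply is_derive_bounded_linear; [exact HL|].
  now apply is_derive_RInt_cont. }
rewrite (RInt_derive_cont _ _ a b Hd); last first.
- intros s. apply continuous_vnorm. intros e.
  destruct (bounded_linear_pos_bound L HL) as [M [HM0 HM]].
  assert (He : 0 < e / M) by (apply Rdiv_lt_0_compat; [apply cond_pos|exact HM0]).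
  generalize (proj1 (continuous_vnorm f s) (Hf s) (mkposreal _ He)).
  apply filter_imp. simpl. intros r Hr.
  rewrite -(real_linear_minus _ _ _ (proj1 HL)).
  eapply Rle_lt_trans; [apply HM|].
  replace (pos e) with (M * (e / M)) by (field; lra).
  now apply Rmult_lt_compat_l.
- rewrite RInt_point (real_linear_zero _ (proj1 HL)).
  unfold minus. rewrite opp_zero. apply vplus_zero_r.
Qed.
End VectorCalculus.

Section OperatorFamilies.
Context {V : CompleteNormedModule R_AbsRing} (cs : C -> V -> V)
  (csR : forall r x, cs (RtoC r) x = scal r x).

(** The bound on compact intervals is a field because products need it, both for strong continuity
    and for the product rule. It passes directly to products and integrals; only for [H] does it
    come from uniform boundedness. *)
Record operator_family (A : R -> V -> V) : Prop := {
  family_plus : forall s x y, A s (plus x y) = plus (A s x) (A s y);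
  family_cs : forall s a x, A s (cs a x) = cs a (A s x);
  family_bound : forall a b, exists M, forall s x,
    a <= s <= b -> norm (A s x) <= M * norm x;
  family_cont : forall x s, continuous (fun r => A r x) s }.

Lemma family_linear A s : operator_family A -> real_linear (A s).
Proof.
intros HA. split; [apply (family_plus A HA)|].
intros r x. rewrite -!csR. apply (family_cs A HA).
Qed.

Lemma family_bounded_linear A s : operator_family A -> bounded_linear (A s).
Proof.
intros HA. split; [now apply family_linear|].
destruct (family_bound A HA s s) as [M HM]. exists M. intros x. apply HM. lra.
Qed.

Lemma family_local_bound A s : operator_family A ->
  exists M, 0 < M /\ forall r x, Rabs (r - s) < 1 -> norm (A r x) <= M * norm x.
Proof.
intros HA. destruct (family_bound A HA (s - 1) (s + 1)) as [M HM].
exists (Rabs M + 1). split; [generalize (Rabs_pos M); lra|].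
intros r x Hr. apply Rabs_def2 in Hr.
eapply Rle_trans; [apply HM; lra|].
apply Rmult_le_compat_r; [apply norm_ge_0|]. generalize (Rle_abs M); lra.
Qed.

(** In $A(\tau')f'-A(\tau)f=A(\tau')(f'-f)+(A(\tau')-A(\tau))f$ the local bound controls the first
    term and strong continuity the second. *)
Lemma family_continuous {U : UniformSpace} A (tau : U -> R) (f : U -> V) z :
  operator_family A -> continuous tau z -> continuous f z ->
  continuous (fun z => A (tau z) (f z)) z.
Proof.
intros HA Ht Hf.
destruct (family_local_bound A (tau z) HA) as [M [HM0 HM]].
assert (Hc : continuous (fun z' => A (tau z') (f z)) z).
{ apply (continuous_comp tau (fun r => A r (f z))); [exact Ht|].
  apply (family_cont A HA). }
apply continuous_vnorm. intros e.
assert (He2 : 0 < e / 2) by (generalize (cond_pos e); lra).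
assert (HeM : 0 < e / 2 / M) by now apply Rdiv_lt_0_compat.
assert (H1 := proj1 (continuous_vnorm _ z) Hc (mkposreal _ He2)).
assert (H2 := proj1 (continuous_vnorm _ z) Hf (mkposreal _ HeM)).
assert (H3 := proj1 (filterlim_locally tau (tau z)) Ht (mkposreal _ Rlt_0_1)).
generalize (filter_and _ _ H1 (filter_and _ _ H2 H3)).
apply filter_imp. simpl. intros z' [K1 [K2 K3]].
eapply Rle_lt_trans; [apply (vnorm_dist_triangle (A (tau z') (f z)))|].
rewrite -(real_linear_minus _ _ _ (family_linear A (tau z') HA)).
assert (K4 := HM (tau z') (minus (f z') (f z)) K3).
apply Rmult_lt_compat_l with (r := M) in K2; [|exact HM0].
replace (M * (e / 2 / M)) with (e / 2) in K2 by (field; lra).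
lra.
Qed.

Lemma vminus_regroup (a b c x y z : V) :
  minus (minus a c) (plus y z)
  = plus (minus (minus a b) x) (plus (minus (minus b c) y) (minus x z)).
Proof.
unfold minus. rewrite vopp_plus -!vplus_assoc. f_equal.
rewrite (vplus_assoc (opp x) b) (vplus_comm (opp x) b) -(vplus_assoc b)
  (vplus_assoc (opp b)) vplus_opp_l vplus_zero_l.
rewrite (vplus_comm (opp x)) -!vplus_assoc. do 2 f_equal.
now rewrite (vplus_comm x) -!vplus_assoc vplus_opp_l vplus_zero_r.
Qed.

(** The product rule for strong derivatives. The error splits into $A(r)$ applied to the error of
    $f$, the error of $A$ at the fixed vector $f(s)$, and $(r-s)(A(r)-A(s))l$; each is at most
    $\frac e3|r-s|$. *)
Lemma is_derive_family A dA (f : R -> V) s l :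
  operator_family A -> (forall x, is_derive (fun r => A r x) s (dA x)) ->
  is_derive f s l ->
  is_derive (fun r => A r (f r)) s (plus (dA (f s)) (A s l)).
Proof.
intros HA HdA Hf.
destruct (family_local_bound A s HA) as [M [HM0 HM]].
apply is_derive_vnorm. intros e.
assert (He3 : 0 < e / 3) by (generalize (cond_pos e); lra).
assert (HeM : 0 < e / 3 / M) by now apply Rdiv_lt_0_compat.
assert (H1 := proj1 (is_derive_vnorm f s l) Hf (mkposreal _ HeM)).
assert (H2 := proj1 (is_derive_vnorm _ s _) (HdA (f s)) (mkposreal _ He3)).
assert (H3 := proj1 (continuous_vnorm _ s) (family_cont A HA l s) (mkposreal _ He3)).
assert (H4 : locally s (fun r => Rabs (r - s) < 1)).
{ exists (mkposreal _ Rlt_0_1). intros r Hr. exact Hr. }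
generalize (filter_and _ _ (filter_and _ _ H1 H2) (filter_and _ _ H3 H4)).
apply filter_imp. simpl. intros r [[K1 K2] [K3 K4]].
set (d := r - s) in *.
assert (Hlin := family_linear A r HA).
assert (Heq : minus (minus (A r (f r)) (A s (f s))) (scal d (plus (dA (f s)) (A s l)))
  = plus (A r (minus (minus (f r) (f s)) (scal d l)))
         (plus (minus (minus (A r (f s)) (A s (f s))) (scal d (dA (f s))))
               (scal d (minus (A r l) (A s l))))).
{ rewrite !(real_linear_minus _ _ _ Hlin) (proj2 Hlin) vscal_plus_r.
  assert (Hd : scal d (minus (A r l) (A s l)) = minus (scal d (A r l)) (scal d (A s l))).
  { unfold minus. rewrite vscal_plus_r. f_equal.
    rewrite -!vscal_opp_one !vscal_assoc. f_equal. lra. }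
  rewrite Hd.
  apply vminus_regroup. }
rewrite Heq.
eapply Rle_trans; [apply vnorm_triangle|].
eapply Rle_trans; [apply Rplus_le_compat_l, vnorm_triangle|].
rewrite vnorm_scal.
apply Rmult_le_compat_l with (r := M) in K1; [|lra].
replace (M * (e / 3 / M * Rabs d)) with (e / 3 * Rabs d) in K1 by (field; lra).
apply Rle_trans with (e / 3 * Rabs d + (e / 3 * Rabs d + Rabs d * (e / 3))); [|lra].
apply Rplus_le_compat; [exact (Rle_trans _ _ _ (HM r _ K4) K1)|].
apply Rplus_le_compat; [exact K2|].
apply Rmult_le_compat_l; [apply Rabs_pos|exact (Rlt_le _ _ K3)].
Qed.

Lemma family_const L : (forall x y, L (plus x y) = plus (L x) (L y)) ->
  (forall a x, L (cs a x) = cs a (L x)) ->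
  (exists M, forall x, norm (L x) <= M * norm x) ->
  operator_family (fun _ => L).
Proof.
intros H1 H2 [M HM]. split; auto.
- intros a b. exists M. intros s x _. apply HM.
- intros x s. apply continuous_const.
Qed.

Lemma family_comp A B : operator_family A -> operator_family B ->
  operator_family (fun s x => A s (B s x)).
Proof.
intros HA HB. split.
- intros s x y. now rewrite (family_plus B HB) (family_plus A HA).
- intros s a x. now rewrite (family_cs B HB) (family_cs A HA).
- intros a b. destruct (family_bound A HA a b) as [M HM].
  destruct (family_bound B HB a b) as [N HN].
  exists (Rabs M * N). intros s x Hs.
  eapply Rle_trans; [now apply HM|].
  apply Rle_trans with (Rabs M * norm (B s x)).
  + apply Rmult_le_compat_r; [apply norm_ge_0|apply Rle_abs].
  + rewrite Rmult_assoc. apply Rmult_le_compat_l; [apply Rabs_pos|now apply HN].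
- intros x s. apply family_continuous; [exact HA|apply continuous_id|].
  apply (family_cont B HB).
Qed.

Lemma family_RInt A t0 :
  (forall a, bounded_linear (cs a)) -> operator_family A ->
  operator_family (fun u x => RInt (fun s => A s x) t0 u).
Proof.
intros Hcs HA.
assert (Hex : forall x u, ex_RInt (fun s => A s x) t0 u)
  by (intros; apply ex_RInt_cont, (family_cont A HA)).
split.
- intros u x y. rewrite -RInt_plus; [|apply Hex|apply Hex].
  apply RInt_ext. intros; apply (family_plus A HA).
- intros u a x. rewrite -RInt_bounded_linear; [|apply Hcs|apply (family_cont A HA)].
  apply RInt_ext. intros; apply (family_cs A HA).
- intros a b.
  (* This interval contains every point between [t0] and [u], on whichever side of [t0] the point
     [u] lies. *)
  destruct (family_bound A HA (Rmin a t0) (Rmax b t0)) as [M HM].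
  exists ((Rabs (b - t0) + Rabs (a - t0)) * Rabs M). intros u x Hu.
  eapply Rle_trans.
  + apply (norm_RInt_le_const_abs (fun s => A s x) t0 u _ (Rabs M * norm x)).
    * intros s Hs. eapply Rle_trans; [apply HM|].
      -- split.
         ++ apply Rle_trans with (Rmin t0 u); [|apply Hs].
            apply Rmin_glb; [apply Rmin_r|]. eapply Rle_trans; [apply Rmin_l|]; lra.
         ++ apply Rle_trans with (Rmax t0 u); [apply Hs|].
            apply Rmax_lub; [apply Rmax_r|]. eapply Rle_trans; [|apply Rmax_l]; lra.
      -- apply Rmult_le_compat_r; [apply norm_ge_0|apply Rle_abs].
    * apply RInt_correct, Hex.
  + rewrite Rmult_assoc. apply Rmult_le_compat_r.
    * apply Rmult_le_pos; [apply Rabs_pos|apply norm_ge_0].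
    * unfold Rabs; repeat destruct Rcase_abs; lra.
- intros x s. apply (@ex_derive_continuous R_AbsRing V).
  exists (A s x). exact (is_derive_RInt_cont (fun s => A s x) t0 s (family_cont A HA x)).
Qed.

(** For fixed $x$ the continuous function $s\mapsto H(s)x$ is bounded on $[a,b]$; uniform
    boundedness, with the points of $[a,b]$ as indices, makes the bound uniform in $x$. *)
Lemma family_of_strongly_continuous (H : R -> V -> V) :
  (forall s, bounded_op cs (H s)) -> strongly_continuous H -> operator_family H.
Proof.
intros HH Hc. split; try (intros; apply HH).
- intros a b.
  destruct (uniform_boundedness {s | a <= s <= b} (fun s => H (proj1_sig s)))
    as [M HM].
  + intros s. split; [apply HH|]. intros r x. rewrite -!csR. apply HH.
  + intros s. apply HH.
  + intros x. destruct (norm_bounded_on_interval (fun s => H s x) a b) as [M HM].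
    * intros s. apply Hc.
    * exists M. intros [s Hs]. now apply HM.
  + exists M. intros s x Hs. exact (HM (exist _ s Hs) x).
- intros x s. apply Hc.
Qed.
End OperatorFamilies.

(** * Continuity of iterated integrals *)

Section ParametricIntegral.
Context {V : CompleteNormedModule R_AbsRing} {U : UniformSpace}.

(** The tube lemma: joint continuity gives a radius around each $(z,s)$, and compactness of $[a,b]$
    gives one radius around $z$ that serves all $s$. *)
Lemma uniform_near_interval (g : U -> R -> V) (a b : R) (z : U) (e : posreal) :
  (forall p : U * R, continuous (fun p => g (fst p) (snd p)) p) ->
  locally z (fun z' => forall s, a <= s <= b -> norm (minus (g z' s) (g z s)) < e).
Proof.
intros Hg.
assert (He2 : 0 < e / 2) by (generalize (cond_pos e); lra).
assert (Hd : forall s, exists d : posreal, forall z' s',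
  ball z d z' -> Rabs (s' - s) < d -> norm (minus (g z' s') (g z s)) < e / 2).
{ intros s.
  destruct (proj1 (continuous_vnorm _ (z, s)) (Hg (z, s)) (mkposreal _ He2))
    as [d Hd].
  exists d. intros z' s' Hz Hs. exact (Hd (z', s') (conj Hz Hs)). }
apply functional_choice in Hd. destruct Hd as [delta Hdelta].
destruct (compactness_value_1d a b delta) as [d Hd].
exists d. intros z' Hz s Hs.
(* Compactness yields the nearby centre [t] only under a double negation, so the estimate is proved
   by contradiction. *)
apply NNPP. intros Hno. apply (Hd s Hs). intros [t [Ht [Hst Hdt]]]. apply Hno.
assert (H1 := Hdelta t z' s (ball_le z _ _ Hdt z' Hz) Hst).
assert (H2 := Hdelta t z s (ball_center z _) Hst).
eapply Rle_lt_trans; [apply (vnorm_dist_triangle (g z t))|].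
rewrite (vnorm_minus_sym (g z t)). lra.
Qed.

Lemma continuous_param_RInt_01 (g : U -> R -> V) (z : U) :
  (forall p : U * R, continuous (fun p => g (fst p) (snd p)) p) ->
  continuous (fun z => RInt (g z) 0 1) z.
Proof.
intros Hg. apply continuous_vnorm. intros e.
assert (He2 : 0 < e / 2) by (generalize (cond_pos e); lra).
assert (Hc : forall z s, continuous (g z) s).
{ intros y s.
  apply (continuous_comp_2 (fun _ : R => y) (fun r : R => r) g);
    [apply continuous_const|apply continuous_id|apply Hg]. }
generalize (uniform_near_interval g 0 1 z (mkposreal _ He2) Hg).
apply filter_imp. simpl. intros z' Hz.
assert (Hi : is_RInt (fun s => minus (g z' s) (g z s)) 0 1
  (minus (RInt (g z') 0 1) (RInt (g z) 0 1))).
{ apply @is_RInt_minus; apply RInt_correct, ex_RInt_cont, Hc. }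
apply Rle_lt_trans with ((1 - 0) * (e / 2)); [|lra].
apply (norm_RInt_le_const (fun s => minus (g z' s) (g z s)) 0 1); [lra| |exact Hi].
intros s Hs. apply Rlt_le. apply Hz. exact Hs.
Qed.

(** The substitution $s=(u(z)-t_0)r+t_0$ moves the variable endpoint into the integrand and leaves
    the fixed interval $[0,1]$. *)
Lemma continuous_param_RInt (g : U -> R -> V) (t0 : R) (u : U -> R) (z : U) :
  (forall p : U * R, continuous (fun p => g (fst p) (snd p)) p) ->
  (forall z, continuous u z) ->
  continuous (fun z => RInt (g z) t0 (u z)) z.
Proof.
intros Hg Hu.
assert (Hc : forall z s, continuous (g z) s).
{ intros y s.
  apply (continuous_comp_2 (fun _ : R => y) (fun r : R => r) g);
    [apply continuous_const|apply continuous_id|apply Hg]. }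
apply continuous_ext with
  (fun z => RInt (fun r => scal (u z - t0) (g z ((u z - t0) * r + t0))) 0 1).
{ intros y. rewrite RInt_comp_lin.
  - f_equal; lra.
  - apply ex_RInt_cont, Hc. }
apply (continuous_param_RInt_01
  (fun z r => scal (u z - t0) (g z ((u z - t0) * r + t0)))).
intros [y r].
assert (Hl : continuous (fun p : U * R => u (fst p) - t0) (y, r)).
{ apply @continuous_minus; [|apply continuous_const].
  apply (continuous_comp fst u); [apply continuous_fst|apply Hu]. }
apply @continuous_scal; [exact Hl|].
apply (continuous_comp_2 fst (fun p : U * R => (u (fst p) - t0) * snd p + t0) g);
  [apply continuous_fst| |apply Hg].
apply @continuous_plus; [|apply continuous_const].
apply @continuous_mult; [exact Hl|apply continuous_snd].
Qed.
End ParametricIntegral.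

Import ssrbool ssrfun eqtype ssrnat seq path.

Section IteratedIntegral.
Context {V : CompleteNormedModule R_AbsRing}.

Definition continuous_env {U : UniformSpace} (env : U -> seq R) : Prop :=
  (forall z z', size (env z) = size (env z')) /\
  (forall i z, continuous (fun z => nth 0%R (env z) i) z).

(** Continuity is tested along continuous families of lists of constant length. The parameter space
    is arbitrary because each integration in [continuous_iint] enlarges it by a factor [R]. *)
Definition env_continuous (F : seq R -> V) : Prop :=
  forall (U : UniformSpace) (env : U -> seq R), continuous_env env ->
  forall z, continuous (fun z => F (env z)) z.

Lemma continuous_env_rcons {U : UniformSpace} (env : U -> seq R) :
  continuous_env env ->
  continuous_env (fun p : U * R => rcons (env (fst p)) (snd p)).
Proof.
move=> [Hsz Hc]; split=> [z z'|i z]; first by rewrite !size_rcons (Hsz _ z'.1).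
apply: (@continuous_ext _ _ (fun p : U * R =>
  if (i < size (env z.1))%N then nth 0%R (env p.1) i
  else if i == size (env z.1) then p.2 else 0%R)).
  by move=> p; rewrite nth_rcons (Hsz p.1 z.1).
case: (i < size (env z.1))%N.
  apply: (continuous_comp fst (fun z => nth 0%R (env z) i)); last exact: Hc.
  by case: z => a b; apply: continuous_fst.
case: (i == size (env z.1)); last exact: continuous_const.
by case: z => a b; apply: continuous_snd.
Qed.

Lemma continuous_iint (F : seq R -> V) t0 k {U : UniformSpace}
  (env : U -> seq R) (u : U -> R) (z : U) :
  env_continuous F -> continuous_env env -> (forall z, continuous u z) ->
  continuous (fun z => iint t0 k (u z) (env z) F) z.
Proof.
move=> HF; elim: k U env u z => [|k IH] U env u z Henv Hu /=; first exact: HF.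
apply: (continuous_param_RInt (fun z s => iint t0 k s (rcons (env z) s) F)) => //.
move=> p.
apply: (IH _ (fun p : U * R => rcons (env p.1) p.2) snd).
  exact: continuous_env_rcons.
by case=> a b; apply: continuous_snd.
Qed.
End IteratedIntegral.

Set Implicit Arguments.
Unset Strict Implicit.

(** * Words of labels and pending subtrees *)

Section VectorSums.
Context {V : CompleteNormedModule R_AbsRing}.
Implicit Types l : seq V.

Lemma vsum_cat l1 l2 : vsum (l1 ++ l2) = plus (vsum l1) (vsum l2).
Proof.
elim: l1 => [|a l1 IH] /=; first by rewrite vplus_zero_l.
by rewrite IH vplus_assoc.
Qed.

Lemma linear_vsum (L : V -> V) l : real_linear L -> L (vsum l) = vsum (map L l).
Proof.
move=> HL; elim: l => [|a l IH] /=; first exact: real_linear_zero.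
by rewrite (proj1 HL) IH.
Qed.

Lemma continuous_vsum (I : Type) {U : UniformSpace} (f : I -> U -> V) (s : seq I) z :
  (forall i, continuous (f i) z) ->
  continuous (fun z => vsum [seq f i z | i <- s]) z.
Proof.
move=> Hf; elim: s => [|i s IH] /=; first exact: continuous_const.
exact: (@continuous_plus _ _ V).
Qed.

Lemma RInt_vsum (I : Type) (f : I -> R -> V) (s : seq I) a b :
  (forall i t, continuous (f i) t) ->
  RInt (fun t => vsum [seq f i t | i <- s]) a b = vsum [seq RInt (f i) a b | i <- s].
Proof.
move=> Hf; elim: s => [|i s IH] /=.
  by rewrite RInt_const; apply: scal_zero_r.
rewrite RInt_plus ?IH //; first by apply: ex_RInt_cont.
by apply: ex_RInt_cont => t; apply: continuous_vsum.
Qed.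

Lemma vsum_if (I : Type) (p : pred I) (a : V) (X : I -> V) (s : seq I) :
  vsum [seq if p i then plus a (X i) else X i | i <- s]
  = plus (vsum (nseq (count p s) a)) (vsum (map X s)).
Proof.
elim: s => [|i s IH] /=; first by rewrite vplus_zero_l.
rewrite IH; case: (p i) => /=.
  by rewrite -!vplus_assoc; congr plus; rewrite !vplus_assoc (vplus_comm (X i)).
by rewrite !vplus_assoc (vplus_comm (X i)).
Qed.

(** Each [s] enters the right-hand side once for every [w] with [p w s], hence once if [q s] and
    never otherwise. This will sort permutations by the place of their next label. *)
Lemma vsum_filter_count (I : Type) (J : eqType) (p : I -> pred J) (q : pred J)
  (F : J -> V) (ws : seq I) (L : seq J) :
  (forall s, s \in L -> count (fun w => p w s) ws = q s :> nat) ->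
  vsum [seq F s | s <- L & q s]
  = vsum [seq vsum [seq F s | s <- L & p w s] | w <- ws].
Proof.
elim: L => [|s L IH] Hc /=.
  by elim: ws {Hc} => [|w ws IH] //=; rewrite -IH vplus_zero_l.
have {}IH := IH (fun s' Hs' => Hc s' (mem_behead (s := s :: L) Hs')).
have Hs : count (p^~ s) ws = q s by apply: Hc; rewrite inE eqxx.
have -> : [seq vsum [seq F i | i <- if p w s then s :: [seq i <- L | p w i]
    else [seq i <- L | p w i]] | w <- ws]
  = [seq if p w s then plus (F s) (vsum [seq F i | i <- L & p w i])
     else vsum [seq F i | i <- L & p w i] | w <- ws].
  by apply: eq_map => w; case: (p w s).
rewrite vsum_if Hs -IH; case: (q s) => /=; first by rewrite vplus_zero_r.
by rewrite vplus_zero_l.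
Qed.
End VectorSums.

Lemma continuous_env_rcons1 (env : seq R) : continuous_env (rcons env).
Proof.
split=> [z z'|i z]; first by rewrite !size_rcons.
apply: (@continuous_ext _ _ (fun p => if (i < size env)%N then nth 0%R env i
  else if i == size env then p else 0%R)).
  by move=> p; rewrite nth_rcons.
case: (i < size env)%N; first exact: continuous_const.
by case: (i == size env); [exact: continuous_id|exact: continuous_const].
Qed.

Definition nonleaf (T : tree) : bool := if T is Leaf then false else true.

(* A word T_0 j_1 T_1 ... j_k T_k is encoded by T_0 and [:: (j_1, T_1); ...].
   It is the in-order reading of a tree whose vertices labelled 1, ..., k have
   been visited, the T_i being the unvisited subtrees. *)
Notation tail := (seq (nat * tree)).

(** The possible successors of a word when [m] is the next label: the root of one pending subtree
    receives [m], and its two subtrees stay pending on either side of it. *)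
Fixpoint expand (m : nat) (T : tree) (r : tail) : seq (tree * tail) :=
  (if T is Node A B then [:: (A, (m, B) :: r)] else [::]) ++
  (if r is (j, T') :: r' then
     [seq (T, (j, w.1) :: w.2) | w <- expand m T' r'] else [::]).

(** This is also the number of integrations still to be carried out. *)
Definition pending (T : tree) (r : tail) : nat :=
  (tsize T + sumn [seq tsize jT.2 | jT <- r])%N.

(** * Operators attached to words, and their derivatives *)

Section WordOperators.
Context {V : CompleteNormedModule R_AbsRing} {cs : C -> V -> V}.
Context (csR : forall r x, cs (RtoC r) x = scal r x).
Context (csL : forall a, bounded_linear (cs a)).
Context (K : bool -> R -> V -> V).
Context (HK : forall b, operator_family cs (K b)).
Context (t0 : R).

(** This is $W_T(u)$ for abstract vertex factors: [K true] will be $\imath PH$ and [K false] will be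
    $-\imath QH$. *)
Fixpoint tree_op (T : tree) (u : R) (y : V) : V :=
  match T with
  | Leaf => y
  | Node A B =>
      RInt (fun s => tree_op A s (K (nonleaf A) s (tree_op B s y))) t0 u
  end.

Lemma tree_op_family T : operator_family cs (tree_op T).
Proof.
elim: T => [|A HA B HB] /=.
  apply: family_const => //; exists 1%R => x; rewrite Rmult_1_l; exact: Rle_refl.
apply: family_RInt => //.
apply: (@family_comp _ cs csR (tree_op A) _ HA).
exact: (@family_comp _ cs csR _ _ (HK _) HB).
Qed.

Definition tree_op_derivative (T : tree) (s : R) (y : V) : V :=
  if T is Node A B then tree_op A s (K (nonleaf A) s (tree_op B s y)) else zero.

Lemma is_derive_tree_op T s y :
  is_derive (fun u => tree_op T u y) s (tree_op_derivative T s y).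
Proof.
case: T => [|A B] /=; first exact: is_derive_const.
apply: (is_derive_RInt_cont (fun s => tree_op A s (K (nonleaf A) s (tree_op B s y)))).
move=> r; apply: (family_continuous cs csR _ (fun r => r)).
- exact: tree_op_family.
- exact: continuous_id.
apply: (family_continuous cs csR _ (fun r => r)).
- exact: HK.
- exact: continuous_id.
exact: (family_cont _ _ (tree_op_family B)).
Qed.

(* The vertex labelled j has a nonempty left subtree iff a pending tree or a
   later label precedes it; [prev] is the preceding label, or 0 if none. *)
Fixpoint word_op (env : seq R) (prev : nat) (T : tree) (r : tail)
  (u : R) (y : V) : V :=
  match r with
  | [::] => tree_op T u y
  | (j, T') :: r' =>
      tree_op T u (K (nonleaf T || (j < prev)%N) (nth 0%R env (j - 1))
        (word_op env j T' r' u y))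
  end.

Lemma continuous_word_op (env : R -> seq R) prev T r y s :
  continuous_env env -> continuous (fun v => word_op (env v) prev T r v y) s.
Proof.
move=> [_ Henv]; elim: r prev T => [|[j T'] r IH] prev T /=.
  exact: (family_cont _ _ (tree_op_family T)).
apply: (family_continuous cs csR _ (fun v => v)).
- exact: tree_op_family.
- exact: continuous_id.
by apply: (family_continuous cs csR); [exact: HK|exact: Henv|exact: IH].
Qed.

(** Some pending subtree is nonempty, and its factor is an integral from [t0] to [t0]. *)
Lemma word_op_at_t0 env prev T r y :
  (0 < pending T r)%N -> word_op env prev T r t0 y = zero.
Proof.
rewrite /pending; elim: r prev T => [|[j T'] r IH] prev [|A B] //=.
- by move=> _; rewrite RInt_point.
- by rewrite add0n => H; rewrite IH // (real_linear_zero _ (family_linear cs csR _ _ (HK _))).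
- by move=> _; rewrite RInt_point.
Qed.

Lemma word_op_rcons env v prev T r u y :
  all (fun jT => 0 < jT.1 <= size env)%N r ->
  word_op (rcons env v) prev T r u y = word_op env prev T r u y.
Proof.
elim: r prev T => [|[j T'] r IH] prev T //= /andP[Hj Hr].
rewrite IH // nth_rcons.
by have -> : (j - 1 < size env)%N by rewrite subn1 prednK; case/andP: Hj.
Qed.

(** By the product rule, each pending subtree is differentiated in turn. Its derivative frees the
    outer integral of $W_{A\vee B}$, so the root becomes a visited vertex whose time is the current
    [s], appended to [env]. *)
Lemma is_derive_word_op env prev T r s y :
  all (fun jT => 0 < jT.1 <= size env)%N r -> (prev <= size env)%N ->
  is_derive (fun u => word_op env prev T r u y) s
    (vsum [seq word_op (rcons env s) prev w.1 w.2 s y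
          | w <- expand (size env).+1 T r]).
Proof.
(* The new label exceeds every earlier one, in particular [prev], so its factor is decided by
   [nonleaf A] alone, as in the derivative of [tree_op]. *)
have Hhead : forall A B r prev, (prev <= size env)%N ->
  word_op (rcons env s) prev A (((size env).+1, B) :: r) s y
  = tree_op A s (K (nonleaf A) s (word_op (rcons env s) (size env).+1 B r s y)).
  move=> A B r0 p Hp /=; rewrite nth_rcons subn1 /= ltnn eqxx.
  by rewrite ltnNge leqW // orbF.
elim: r prev T => [|[j T'] r IH] prev T /=.
  move=> _ Hp; rewrite cats0.
  have := is_derive_tree_op T s y; case: T => [|A B] //=.
  by move: (Hhead A B [::] prev Hp) => /= ->; rewrite vplus_zero_r.
case/andP=> Hj Hr Hp.
rewrite map_cat vsum_cat -map_comp.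
pose f := fun u : R => K (nonleaf T || (j < prev)%N) (nth 0%R env (j - 1)) (word_op env j T' r u y).
have -> : vsum [seq word_op (rcons env s) prev w.1 w.2 s y
    | w <- if T is Node A B then [:: (A, ((size env).+1, B) :: (j, T') :: r)] else [::]]
  = tree_op_derivative T s (f s).
  rewrite /f; case: T {f} => [|A B] //=.
  move: (Hhead A B ((j, T') :: r) prev Hp) => /= ->.
  rewrite vplus_zero_r /=; case/andP: (Hj) => Hj0 Hj1.
  (* Before the expansion, [j] followed the nonempty tree [Node A B]; now it follows [B], which may
     be empty, but the preceding label is larger than [j]. Its factor is [K true] in both cases. *)
  rewrite (_ : j < (size env).+1)%N // orbT nth_rcons.
  have -> : (j - 1 < size env)%N by rewrite subn1 prednK.
  by rewrite word_op_rcons.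
(* The remaining successors expand a subtree to the right of [j]; linearity takes their sum inside
   the operators on the left. *)
set l := (X in plus _ X).
have -> : l = tree_op T s (K (nonleaf T || (j < prev)%N) (nth 0%R env (j - 1))
    (vsum [seq word_op (rcons env s) j w.1 w.2 s y | w <- expand (size env).+1 T' r])).
  rewrite (linear_vsum _ (family_linear cs csR _ _ (HK _))).
  rewrite (linear_vsum _ (family_linear cs csR _ _ (tree_op_family T))) -!map_comp.
  rewrite /l; congr vsum; apply: eq_map => w /=.
  rewrite nth_rcons; have -> // : (j - 1 < size env)%N.
  by rewrite subn1 prednK; case/andP: Hj.
apply: (is_derive_family cs csR _ _ f).
- exact: tree_op_family.
- by move=> x; apply: is_derive_tree_op.
rewrite /f; apply: is_derive_bounded_linear.
  exact: (family_bounded_linear cs csR).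
by apply: IH => //; case/andP: Hj.
Qed.

(** The fundamental theorem of calculus, with boundary term zero by [word_op_at_t0]. *)
Lemma word_op_expand env T r u y :
  all (fun jT => 0 < jT.1 <= size env)%N r -> (0 < pending T r)%N ->
  RInt (fun s => vsum [seq word_op (rcons env s) 0 w.1 w.2 s y
                      | w <- expand (size env).+1 T r]) t0 u
  = word_op env 0 T r u y.
Proof.
move=> Hr Hp.
rewrite (RInt_derive_cont (fun u => word_op env 0 T r u y)).
- rewrite word_op_at_t0 // /minus opp_zero; exact: vplus_zero_r.
- by move=> s; apply: is_derive_word_op.
move=> s; apply: continuous_vsum => w; apply: continuous_word_op.
exact: continuous_env_rcons1.
Qed.
End WordOperators.

Import zify.zify.
Local Open Scope nat_scope.

(** * Permutations with a given tree *)

Lemma tree_eqP : Equality.axiom tree_eqb.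
Proof.
move=> T T'; apply: (iffP idP) => [|<-]; last by elim: T => //= A -> B ->.
by elim: T T' => [|A HA B HB] [|A' B'] //= /andP[/HA-> /HB->].
Qed.

HB.instance Definition _ := hasDecEq.Build tree tree_eqP.

Lemma foldr_minn_mem (i : nat) I : foldr minn i I \in i :: I.
Proof.
elim: I => [|x I IH] /=; first by rewrite inE.
rewrite /minn; case: ifP => _; first by rewrite !inE eqxx orbT.
by move: IH; rewrite !inE => /orP[->|->] //; rewrite !orbT.
Qed.

Lemma foldr_minn_le (i x : nat) I : x \in i :: I -> foldr minn i I <= x.
Proof.
elim: I => [|y I IH] /=; first by rewrite inE => /eqP->.
rewrite !inE geq_min => /or3P[/eqP e|/eqP->|H]; last 2 first.
- by rewrite leqnn.
- by rewrite IH ?orbT // inE H orbT.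
by rewrite IH ?orbT // inE e eqxx.
Qed.

(** Both parts of a split get the fuel of the whole list, which exceeds their lengths; this lemma
    removes the excess. *)
Lemma phi_fuel_enough k I : size I <= k -> phi_fuel k I = phi I.
Proof.
rewrite /phi; have [n] := ubnP (size I); elim: n k I => // n IH [|k] [|i I] //=.
(* The conditional named [j] is the unfolded [index m (i :: I)]. *)
rewrite !ltnS => Hn Hk; set m := foldr minn i I; set j := if _ == _ then _ else _.
have Hj : j < (size I).+1.
  by have := foldr_minn_mem i I; rewrite -index_mem.
congr Node.
- have Hs : size (take j (i :: I)) <= size I by rewrite size_take /= Hj.
  by rewrite !IH //; lia.
- have Hs : size (drop j I) <= size I by rewrite size_drop; lia.
  by rewrite !IH //; lia.
Qed.

(** As [index] finds the first occurrence of the minimum, strict inequality is asked of [I1]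
    only. *)
Lemma phi_split m I1 I2 :
  all (fun x => m < x) I1 -> all (fun x => m <= x) I2 ->
  phi (I1 ++ m :: I2) = Node (phi I1) (phi I2).
Proof.
move=> H1 H2; set I := I1 ++ m :: I2.
have Hm : forall i I', I = i :: I' -> foldr minn i I' = m.
  move=> i I' e; apply/eqP; rewrite eqn_leq foldr_minn_le /=; last first.
    by rewrite -e mem_cat inE eqxx orbT.
  have := foldr_minn_mem i I'; rewrite -e mem_cat inE => /or3P[|/eqP->//|].
    by move/(allP H1)/ltnW.
  by move/(allP H2).
have Hidx : index m I = size I1.
  rewrite index_cat /= eqxx addn0; case: ifP => // /(allP H1).
  by rewrite ltnn.
rewrite /phi; case e : {1 2}I => [|i I'] /=; first by move: e; rewrite /I; case: (I1).
rewrite (Hm _ _ e).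
have -> : (if i == m then 0 else (index m I').+1) = size I1 by rewrite -Hidx e.
rewrite -!/(drop _.+1 (i :: I')) -e /I take_size_cat //.
have -> : drop (size I1) I' = I2.
  by rewrite -[LHS]/(drop (size I1).+1 (i :: I')) -e /I -cat_rcons drop_size_cat ?size_rcons.
have Hs : size I' = size I1 + size I2.
  by have := congr1 size e; rewrite /I size_cat /=; lia.
by rewrite !phi_fuel_enough //; lia.
Qed.

Lemma tsize_phi I : tsize (phi I) = size I.
Proof.
have [n] := ubnP (size I); elim: n I => // n IH [|i I] //=.
rewrite ltnS => Hn; rewrite /phi /=; set m := foldr minn i I; set j := if _ == _ then _ else _.
have Hj : j < (size I).+1.
  by have := foldr_minn_mem i I; rewrite -index_mem.
have H1 : size (take j (i :: I)) = j by rewrite size_take /= Hj.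
have H2 : size (drop j I) = size I - j by rewrite size_drop.
by rewrite !phi_fuel_enough ?H1 ?H2 ?IH ?H1 ?H2 //; lia.
Qed.

(** The permutations compatible with a partial visit: the segments of [s] between the visited labels
    have the pending subtrees as their images under [phi]. As [phi] preserves size, the cuts are at
    positions given by [tsize]; the bound [tsize T < size s] excludes the default value of [nth]. *)
Fixpoint word_match (T : tree) (r : tail) (s : seq nat) : bool :=
  match r with
  | [::] => phi s == T
  | (j, T') :: r' =>
      [&& phi (take (tsize T) s) == T, tsize T < size s,
          nth 0 s (tsize T) == j & word_match T' r' (drop (tsize T).+1 s)]
  end.

Definition labels (r : tail) : seq nat := [seq jT.1 | jT <- r].

Lemma word_match_labels T r s :
  word_match T r s -> {subset labels r <= s}.
Proof.
elim: r T s => [|[j T'] r IH] T s //= /and4P[_ Hsz /eqP Hj Hm] x.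
rewrite inE => /orP[/eqP->|Hx]; first by rewrite -Hj mem_nth.
exact: mem_drop (IH _ _ Hm _ Hx).
Qed.

Lemma expand_pending m T r w :
  w \in expand m T r -> pending T r = (pending w.1 w.2).+1.
Proof.
rewrite /pending; elim: r T w => [|[j T'] r IH] T w /=.
  by rewrite cats0; case: T => [|A B] //; rewrite inE => /eqP-> /=; lia.
rewrite mem_cat => /orP[|/mapP[w' /IH H ->]]; last by rewrite /= H addnS.
by case: T => [|A B] //; rewrite inE => /eqP-> /=; lia.
Qed.

Lemma expand_labels m T r w :
  w \in expand m T r -> perm_eq (labels w.2) (m :: labels r).
Proof.
rewrite /labels; elim: r T w => [|[j T'] r IH] T w /=.
  by rewrite cats0; case: T => [|A B] //; rewrite inE => /eqP->.
rewrite mem_cat => /orP[|/mapP[w' /IH H ->]] /=.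
  by case: T => [|A B] //; rewrite inE => /eqP->.
rewrite -(perm_cons j) in H; apply: (perm_trans H).
by apply/permP => a /=; rewrite addnCA.
Qed.

(** The root of [phi s] is the minimum [m], and [tsize_phi] forces it to position [tsize A].
    Equality of trees thus becomes a test at a fixed position, in the form used by [word_match]. *)
Lemma phi_eq_Node m s A B :
  uniq s -> m \in s -> (forall x, x \in s -> m <= x) ->
  (phi s == Node A B) =
  [&& phi (take (tsize A) s) == A, tsize A < size s, nth 0 s (tsize A) == m
    & phi (drop (tsize A).+1 s) == B].
Proof.
move=> Hu Hm Hmin.
case/splitPr: s / Hm Hu Hmin => s1 s2.
rewrite cat_uniq /= => /and4P[Hu1 /norP[Hm1 Hd] Hm2 Hu2] Hmin.
have -> : phi (s1 ++ m :: s2) = Node (phi s1) (phi s2).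
  apply: phi_split; apply/allP => x Hx; last first.
    by apply: Hmin; rewrite mem_cat inE Hx !orbT.
  rewrite ltn_neqAle Hmin ?andbT ?mem_cat ?Hx //.
  by apply: contraNneq Hm1 => ->.
rewrite -[LHS]/((phi s1 == A) && (phi s2 == B)).
have [e|ne] := eqVneq (tsize A) (size s1).
  rewrite e take_size_cat // size_cat /= nth_cat ltnn subnn eqxx.
  rewrite -cat_rcons drop_size_cat ?size_rcons //.
  by rewrite (_ : size s1 < size s1 + (size s2).+1) // addnS ltnS leq_addr.
have -> : (phi s1 == A) = false.
  by apply: contra_neqF ne => /eqP<-; rewrite tsize_phi.
apply/esym/negbTE/negP => /and4P[_ Hlt /eqP Hn _].
case/negP: ne; rewrite -(@nth_uniq _ 0 (s1 ++ m :: s2)) //.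
- by rewrite Hn nth_cat ltnn subnn.
- by rewrite size_cat /= addnS ltnS leq_addr.
by rewrite cat_uniq /= Hu1 Hm2 Hu2 negb_or Hm1 Hd.
Qed.

(** The conditions on [A], [m] and [B] are gathered on the initial segment that belonged to
    [Node A B], where [phi_eq_Node] applies; the other conditions are those for the unexpanded
    word. *)
Lemma word_match_head m A B j T' r s :
  word_match A ((m, B) :: (j, T') :: r) s =
  [&& phi (take (tsize A) (take (tsize (Node A B)) s)) == A,
      tsize A < size (take (tsize (Node A B)) s),
      nth 0 (take (tsize (Node A B)) s) (tsize A) == m,
      phi (drop (tsize A).+1 (take (tsize (Node A B)) s)) == B,
      tsize (Node A B) < size s,
      nth 0 s (tsize (Node A B)) == j
    & word_match T' r (drop (tsize (Node A B)).+1 s)].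
Proof.
rewrite /=; set a := tsize A; set b := tsize B.
rewrite take_takel; last by lia.
rewrite nth_take; last by lia.
rewrite nth_drop drop_drop size_drop size_take.
have -> : (a + b).+1 = b + a.+1 by lia.
rewrite -take_drop (_ : a.+1 + b = b + a.+1); last by lia.
rewrite (_ : b.+1 + a.+1 = (b + a.+1).+1); last by lia.
have [Hlt|Hge] := ltnP (b + a.+1) (size s); last first.
  have -> : (b < size s - a.+1) = false by lia.
  by rewrite !andbF.
have -> : b < size s - a.+1 by lia.
have -> : a < size s by lia.
by have -> : a < b + a.+1 by lia.
Qed.

(** The least unvisited label [m] lies in exactly one segment of a matching [s] and is the root of
    that segment's tree, so exactly one successor matches. The factor [m \in s] serves the
    induction, where [m] may be missing from the rest of [s]. *)
Lemma word_match_expand m T r s :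
  uniq s -> m \notin labels r ->
  (forall x, x \in s -> (m <= x) || (x \in labels r)) ->
  count (fun w => word_match w.1 w.2 s) (expand m T r)
  = (m \in s) && word_match T r s :> nat.
Proof.
have Hnot : forall T r s, m \notin s ->
    count (fun w => word_match w.1 w.2 s) (expand m T r) = 0.
  move=> T0 r0 s0 Hm; apply/eqP; rewrite -leqn0 leqNgt -has_count.
  apply/hasPn => w Hw; apply: contra Hm => /word_match_labels; apply.
  by rewrite (perm_mem (expand_labels Hw)) inE eqxx.
elim: r T s => [|[j T'] r IH] T s Hu Hmr Hle;
  (have [Hm|Hm] := boolP (m \in s); last by rewrite Hnot).
  rewrite /= cats0; case: T => [|A B] /=.
    have := tsize_phi s; case: (phi s) => //= /esym/size0nil e.
    by rewrite e in Hm.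
  rewrite addn0 (@phi_eq_Node m) // => x Hx.
  by have := Hle _ Hx; rewrite orbF.
move: Hmr; rewrite inE negb_or => /andP[Hmj Hmr].
set n := tsize T.
set head := if T is Node A B then [:: (A, (m, B) :: (j, T') :: r)] else [::].
(* The successors either expand [T] or keep [T] and expand the rest of the word. *)
have Hcount : count (fun w => word_match w.1 w.2 s) (expand m T ((j, T') :: r))
    = count (fun w => word_match w.1 w.2 s) head
      + (if [&& phi (take n s) == T, n < size s & nth 0 s n == j] then
           count (fun w => word_match w.1 w.2 (drop n.+1 s)) (expand m T' r)
         else 0).
  rewrite -[expand _ _ _]/(head ++ [seq (T, (j, w.1) :: w.2) | w <- expand m T' r]).
  rewrite count_cat count_map; congr addn; case: ifP => H.
    by apply: eq_count => w /=; move: H; rewrite -/n => /and3P[-> -> ->].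
  apply/eqP; rewrite -leqn0 leqNgt -has_count; apply/hasPn => w _ /=.
  by rewrite -/n; apply: contraFN H => /and4P[-> -> -> _].
rewrite {}Hcount.
(* If [j] is not at position [n], neither the word nor any of its successors matches. *)
have [/andP[Hn /eqP Hj]|HF] := boolP ((n < size s) && (nth 0 s n == j)); last first.
  rewrite (_ : word_match T _ s = false); last first.
    by apply/negbTE; apply: contra HF => /and4P[_ -> -> _].
  rewrite !andbF addn0 {}/head; move: @n HF; case: (T) => // A B n HF.
  rewrite /count word_match_head.
  by move: HF; rewrite /n; case: (_ < size s); case: (_ == j); rewrite ?andbF.
have Hs : s = take n s ++ j :: drop n.+1 s.
  by rewrite -Hj -drop_nth // cat_take_drop.
have [Hu0 Hj0 Hdis Hjs Hus] : [/\ uniq (take n s), j \notin take n s,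
    ~~ has (mem (take n s)) (drop n.+1 s), j \notin drop n.+1 s
    & uniq (drop n.+1 s)].
  by move: Hu; rewrite {1}Hs cat_uniq /= negb_or =>
    /and3P[-> /andP[-> ->] /andP[-> ->]].
have Hlabel x : x \in drop n.+1 s -> x != j.
  by move=> Hx; apply: contraNneq Hjs => <-.
rewrite andTb andbT IH //; last first.
  move=> x Hx; have := Hle x (mem_drop Hx).
  by rewrite inE (negbTE (Hlabel x Hx)).
have -> : word_match T ((j, T') :: r) s
    = (phi (take n s) == T) && word_match T' r (drop n.+1 s).
  by rewrite /= -/n Hn Hj eqxx.
(* As [s] has no repetitions, [m] lies on one side of [j] only, and successors that place it on the
   other side do not match. *)
have [Hmd|Hmd] := boolP (m \in drop n.+1 s).
  rewrite [X in X + _](_ : _ = 0); first by case: ifP.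
  have Hm0 : m \notin take n s by apply: contra Hdis => H; apply/hasP; exists m.
  rewrite {}/head; move: @n Hm0 {Hn Hj Hs Hu0 Hj0 Hdis Hjs Hus Hlabel Hmd}.
  case: (T) => // A B n Hm0; rewrite /count word_match_head -/n.
  case: (ltnP (tsize A) (size (take n s))) => [Ha|_]; last by rewrite !andbF.
  have /negbTE-> : nth 0 (take n s) (tsize A) != m.
    by apply: contraNneq Hm0 => <-; apply: mem_nth.
  by rewrite !andbF.
have Hm0 : m \in take n s.
  by move: Hm; rewrite {1}Hs mem_cat inE (negbTE Hmj) (negbTE Hmd) !orbF.
rewrite [X in _ + X](_ : _ = 0); last by case: ifP.
rewrite addn0.
have [Hmatch|Hmatch] := boolP (word_match T' r (drop n.+1 s)); last first.
  rewrite andbF {}/head; move: @n Hmatch {Hn Hj Hs Hu0 Hj0 Hdis Hjs Hus Hlabel Hmd Hm0}.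
  by case: (T) => // A B n Hmatch; rewrite /count word_match_head -/n (negbTE Hmatch) !andbF.
(* The labels already visited are [j] and those of [r], which occur in the rest of [s]; none is in
   the first segment. *)
have Hmin x : x \in take n s -> m <= x.
  move=> Hx; have := Hle x (mem_take Hx); case/orP => //.
  rewrite inE /= => /orP[/eqP e|Hx']; first by rewrite -e Hx in Hj0.
  by case/hasP: Hdis; exists x => //; apply: word_match_labels Hmatch _ Hx'.
rewrite andbT {}/head; move: @n Hn Hj Hmatch Hu0 Hm0 Hmin {Hs Hj0 Hdis Hjs Hus Hlabel Hmd}.
case: (T) => [|A B] n Hn Hj Hmatch Hu0 Hm0 Hmin.
  by rewrite take0 in Hm0.
rewrite /count word_match_head -/n Hn Hj eqxx Hmatch !andbT addn0.
by rewrite (phi_eq_Node _ _ Hu0 Hm0 Hmin).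
Qed.

Lemma word_match_complete T r s :
  pending T r = 0 -> word_match T r s = (s == labels r).
Proof.
rewrite /pending; elim: r T s => [|[j T'] r IH] [|A B] s //=.
  by move=> _; case: s => // i s; apply/negbTE/eqP => /(congr1 tsize); rewrite tsize_phi.
rewrite add0n => H; case: s => [|i s] //=.
by rewrite drop0 IH // take0 eqseq_cons.
Qed.

(** * Summation over the permutations that match a word *)

Section SumOverWords.
Context {V : CompleteNormedModule R_AbsRing} {cs : C -> V -> V}.
Context (csR : forall r x, cs (RtoC r) x = scal r x).
Context (csL : forall a, bounded_linear (cs a)).
Context (K : bool -> R -> V -> V).
Context (HK : forall b, operator_family cs (K b)).
Context (t0 : R) (n : nat) (F : seq nat -> seq R -> V) (y : V).
Context (HF : forall s, env_continuous (F s)).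
Hypothesis HF0 : forall r s env u, perm_eq s (iota 1 n) -> size env = n ->
  pending Leaf r = 0 -> labels r = s ->
  F s env = word_op K t0 env 0 Leaf r u y.

(** Induction on the number of remaining integrations. A step moves the sum inside the outer
    integral, sorts the permutations by the place of the next label [(size env).+1], and integrates
    by [word_op_expand]. At the end one permutation remains, the list of labels itself. *)
Lemma vsum_iint_word T r env u :
  perm_eq (labels r) (iota 1 (size env)) -> size env + pending T r = n ->
  vsum [seq iint t0 (pending T r) u env (F s)
       | s <- permutations (iota 1 n) & word_match T r s]
  = word_op K t0 env 0 T r u y.
Proof.
move Hk: (pending T r) => k.
elim: k T r env u Hk => [|k IH] T r env u Hk Hl Hn /=.
  have -> : [seq s <- permutations (iota 1 n) | word_match T r s] = [:: labels r].
    have -> : [seq s <- permutations (iota 1 n) | word_match T r s]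
      = [seq s <- permutations (iota 1 n) | pred1 (labels r) s].
      by apply: eq_filter => s; rewrite word_match_complete.
    rewrite filter_pred1_uniq ?permutations_uniq // mem_permutations.
    by rewrite -Hn addn0.
  rewrite addn0 in Hn.
  have e : T = Leaf by move: Hk; rewrite /pending; case: (T).
  rewrite /= vplus_zero_r e; apply: HF0 => //; first by rewrite -Hn.
  by rewrite -e.
have Hr : all (fun jT => 0 < jT.1 <= size env) r.
  apply/allP => jT HjT; have : jT.1 \in labels r by apply: map_f.
  by rewrite (perm_mem Hl) mem_iota add1n ltnS.
rewrite -(word_op_expand csR csL HK) ?Hk //.
rewrite -RInt_vsum; last first.
  move=> s t; apply: (continuous_iint (F s) t0 k (rcons env) (fun v => v)).
  - exact: HF.
  - exact: continuous_env_rcons1.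
  - by move=> v; apply: continuous_id.
apply: RInt_ext => v _.
rewrite (@vsum_filter_count _ _ _ (fun w s => word_match w.1 w.2 s)
  (word_match T r) _ (expand (size env).+1 T r)); last first.
  move=> s; rewrite mem_permutations => Hs.
  have Hin : (size env).+1 \in s by rewrite (perm_mem Hs) mem_iota; lia.
  rewrite word_match_expand ?Hin //.
  - by rewrite (perm_uniq Hs) iota_uniq.
  - by rewrite (perm_mem Hl) mem_iota add1n ltnn andbF.
  move=> x; rewrite (perm_mem Hs) (perm_mem Hl) !mem_iota; lia.
congr vsum; apply/eq_in_map => w Hw.
have Hp := expand_pending Hw.
apply: IH; first by move: Hp; rewrite Hk => -[].
- rewrite size_rcons; apply: (perm_trans (expand_labels Hw)).
  apply: (@perm_trans _ ((size env).+1 :: iota 1 (size env))); first by rewrite perm_cons.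
  rewrite (_ : iota 1 (size env).+1 = rcons (iota 1 (size env)) (size env).+1).
    by rewrite perm_sym perm_rcons.
  by rewrite -[in LHS](addn1 (size env)) iotaD cats1 add1n.
- by rewrite size_rcons; lia.
Qed.
End SumOverWords.

(** * The operators of a tree *)

Section ComplexHilbert.
Context {V : CompleteNormedModule R_AbsRing} {cs : C -> V -> V} {ip : V -> V -> C}.
Context (HV : is_complex_hilbert cs ip).

Lemma hilbert_cs_real r x : cs (RtoC r) x = scal r x.
Proof. by case: HV. Qed.

Lemma hilbert_cs_plus a x y : cs a (plus x y) = plus (cs a x) (cs a y).
Proof. by case: HV => _ [_ [_ [H _]]]. Qed.

Lemma hilbert_cs_comm a b x : cs a (cs b x) = cs b (cs a x).
Proof. by case: HV => _ [H _]; rewrite !H Cmult_comm. Qed.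

(** The inner product is conjugate linear in its second argument by symmetry, so $\langle
    ax,ax\rangle$ has real part $|a|^2\,\mathrm{Re}\langle x,x\rangle$. *)
Lemma hilbert_norm_cs a x : norm (cs a x) = (Cmod a * norm x)%R.
Proof.
case: HV => _ [_ [_ [_ [_ [Hip [Hconj [Hpos [_ Hnorm]]]]]]]].
rewrite !Hnorm Hip (Hconj (cs a x) x) Hip /Cmod -sqrt_mult_alt.
  by congr sqrt; case: a => a b; case: (ip x x) => c d; rewrite /Cmult /Cconj /=; ring.
by apply: Rplus_le_le_0_compat; rewrite -Rsqr_pow2; apply: Rle_0_sqr.
Qed.

Lemma hilbert_cs_bounded_linear a : bounded_linear (cs a).
Proof.
split; first split=> [x y|r x]; first exact: hilbert_cs_plus.
  by rewrite -!hilbert_cs_real hilbert_cs_comm.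
by exists (Cmod a) => x; rewrite hilbert_norm_cs; apply: Rle_refl.
Qed.

Lemma family_of_bounded_op L : bounded_op cs L -> operator_family cs (fun _ => L).
Proof. by case=> H1 [H2 H3]; apply: family_const. Qed.

Lemma family_cs_const a : operator_family cs (fun _ => cs a).
Proof.
apply: family_const; [exact: hilbert_cs_plus| |].
  by move=> b x; exact: hilbert_cs_comm.
exact: (proj2 (hilbert_cs_bounded_linear a)).
Qed.

Lemma family_Qop P : bounded_op cs P -> operator_family cs (fun _ => Qop P).
Proof.
case=> H1 [H2 [M HM]]; apply: family_const.
- move=> x y; rewrite /Qop H1 /minus vopp_plus -!vplus_assoc; congr plus.
  by rewrite !vplus_assoc (vplus_comm y).
- move=> a x; rewrite /Qop H2.
  by rewrite (real_linear_minus _ _ _ (proj1 (hilbert_cs_bounded_linear a))).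
exists (1 + M)%R => x; apply: (Rle_trans _ _ _ (vnorm_minus_le x (P x))).
by have := HM x; lra.
Qed.
End ComplexHilbert.

(** * Identification of $\Omega_T$ with $W_TP$, and the recursions *)

Section Omega.
Context {V : CompleteNormedModule R_AbsRing} {cs : C -> V -> V} {ip : V -> V -> C}.
Context (HV : is_complex_hilbert cs ip).
Context {H : R -> V -> V} {P : V -> V}.
Context (HH : operator_family cs H).
Context (HP : bounded_op cs P).
Context (t0 : R).

Definition vertex_op (b : bool) (s : R) (y : V) : V :=
  if b then cs Ci (P (H s y)) else cs (Copp Ci) (Qop P (H s y)).

Let csR := hilbert_cs_real HV.
Let csL := hilbert_cs_bounded_linear HV.

Lemma vertex_op_family b : operator_family cs (vertex_op b).
Proof.
rewrite /vertex_op; case: b.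
  apply: (@family_comp _ cs csR (fun _ => cs Ci)); first exact: (family_cs_const HV).
  by apply: (@family_comp _ cs csR (fun _ => P)) => //; apply: family_of_bounded_op.
apply: (@family_comp _ cs csR (fun _ => cs (Copp Ci))); first exact: (family_cs_const HV).
by apply: (@family_comp _ cs csR (fun _ => Qop P)) => //; exact: (family_Qop HV).
Qed.

(** Positions count from 0 here and from 1 in [Xfactor]. The projection that closes the last factor
    is moved into the argument, which leaves the same two factors at all positions. *)
Lemma Xfactor_vertex_op n s p t x :
  uniq s -> size s = n -> p < n ->
  Xfactor cs H P n s p.+1 t x
  = vertex_op ((0 < p) && (nth 0 s p < nth 0 s p.-1)) t (if p.+1 == n then P x else x).
Proof.
move=> Hu Hs Hp; rewrite /Xfactor /vertex_op /mI /mmI.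
rewrite !subSS subn0 subn1.
case: p Hp => [|p] Hp /=.
  by have [e|ne] := eqVneq n 1; rewrite ?e //= (eq_sym 1) (negbTE ne).
have -> : (n == 1) = false by lia.
(* Neighbouring labels differ, so a step that is not an ascent is a descent. *)
have Hne : nth 0 s p != nth 0 s p.+1 by rewrite nth_uniq ?Hs //; lia.
have -> : (nth 0 s p.+1 < nth 0 s p) = ~~ (nth 0 s p < nth 0 s p.+1).
  by rewrite -leqNgt [RHS]leq_eqVlt eq_sym (negbTE Hne).
have [Hlt|Hge] := ltnP p.+2 n.
  have -> : (p.+2 == n) = false by lia.
  by case: ifP.
have -> : p.+2 == n by lia.
by case: ifP.
Qed.

Lemma env_continuous_Xprod n s x :
  env_continuous (fun env => Xprod cs H P n s env x).
Proof.
have HX p : operator_family cs (Xfactor cs H P n s p).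
  have HPP : operator_family cs (fun t x => H t (P x)).
    by apply: (@family_comp _ cs csR H (fun _ => P)) => //; apply: family_of_bounded_op.
  have HcQ A : operator_family cs A -> operator_family cs (fun t x => cs (Copp Ci) (Qop P (A t x))).
    move=> HA; apply: (@family_comp _ cs csR (fun _ => cs (Copp Ci))).
      exact: (family_cs_const HV).
    by apply: (@family_comp _ cs csR (fun _ => Qop P)) => //; exact: (family_Qop HV).
  have HcP A : operator_family cs A -> operator_family cs (fun t x => cs Ci (P (A t x))).
    move=> HA; apply: (@family_comp _ cs csR (fun _ => cs Ci)); first exact: (family_cs_const HV).
    by apply: (@family_comp _ cs csR (fun _ => P)) => //; apply: family_of_bounded_op.
  rewrite /Xfactor; case: (n == 1); first exact: HcQ.
  case: (p == 1); first exact: HcQ.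
  by case: (p < n); case: (_ < _); [exact: HcQ|exact: HcP|exact: HcQ|exact: HcP].
move=> U env [_ Henv] z; rewrite /Xprod.
elim: (iota 1 n) => [|p l IH] /=; first exact: continuous_const.
by apply: (family_continuous cs csR); [exact: HX|exact: Henv|exact: IH].
Qed.

Lemma Xprod_word_op n r s env u x :
  perm_eq s (iota 1 n) -> 0 < n -> pending Leaf r = 0 -> labels r = s ->
  Xprod cs H P n s env x = word_op vertex_op t0 env 0 Leaf r u (P x).
Proof.
move=> Hs Hn; rewrite /Xprod /pending add0n.
have Hu : uniq s by rewrite (perm_uniq Hs) iota_uniq.
have Hsz : size s = n by rewrite (perm_size Hs) size_iota.
(* The induction runs over the suffixes of the product. At [p = 0] the preceding label is set to 0,
   and no label is smaller, which matches the factor $-\imath QH$ at the first position. *)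
suff Hgen : forall r p, p < n -> sumn [seq tsize jT.2 | jT <- r] = 0 ->
    labels r = drop p s ->
    foldr (fun q acc => Xfactor cs H P n s q
        (nth 0%R env (nth 0 s (q - 1) - 1)) acc) x (iota p.+1 (n - p))
    = word_op vertex_op t0 env (if p is p'.+1 then nth 0 s p' else 0) Leaf r u (P x)
      :> V.
  by move=> Hr Hl; rewrite -(Hgen r 0) ?drop0 ?subn0.
elim=> [|[j T'] r' IH] p Hp /=.
  by move=> _ /esym/(congr1 size); rewrite size_drop Hsz /=; lia.
case: T' => //; rewrite add0n => Hr.
rewrite (drop_nth 0) ?Hsz // => -[-> Hl].
have -> : n - p = (n - p.+1).+1 by lia.
rewrite /= Xfactor_vertex_op // !subn1 /=.
have -> : ((0 < p) && (nth 0 s p < nth 0 s p.-1))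
    = (nth 0 s p < (if p is p'.+1 then nth 0 s p' else 0)) by case: (p).
congr (vertex_op _ _ _).
have [e|ne] := eqVneq p.+1 n.
  rewrite e subnn /=; case: r' Hr Hl {IH} => //= jT r' _ /(congr1 size).
  by rewrite size_drop Hsz e subnn.
by rewrite (IH p.+1) //; lia.
Qed.

(** This is [vsum_iint_word] for the word without labels, whose only pending subtree is [T]; the
    permutations that match it are those of [S_T]. *)
Lemma Omega_tree_op T t x :
  Omega cs H P T t t0 x = tree_op vertex_op t0 T t (P x).
Proof.
case: T => // A B.
rewrite -[RHS]/(word_op vertex_op t0 [::] 0 (Node A B) [::] t (P x)).
have Hp : pending (Node A B) [::] = tsize (Node A B) by rewrite /pending addn0.
rewrite -(@vsum_iint_word _ _ csR csL _ vertex_op_family t0 (tsize (Node A B))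
  (fun s env => Xprod cs H P (tsize (Node A B)) s env x)) ?Hp //.
- by move=> s; exact: env_continuous_Xprod.
by move=> r s env u Hs _ Hr Hl; apply: Xprod_word_op.
Qed.

Lemma Omega_node_leaf T t x :
  Omega cs H P (Node Leaf T) t t0 x
  = cs (Copp Ci) (RInt (fun s => Qop P (H s (Omega cs H P T s t0 x))) t0 t).
Proof.
rewrite Omega_tree_op /= -RInt_bounded_linear.
- by apply: RInt_ext => s _; rewrite Omega_tree_op.
- exact: csL.
move=> s.
apply: (@continuous_ext _ _ (fun s => Qop P (H s (tree_op vertex_op t0 T s (P x))))).
  by move=> r; rewrite Omega_tree_op.
apply: (family_continuous cs csR (fun _ => Qop P) (fun r => r)).
- exact: (family_Qop HV).
- exact: continuous_id.
apply: (family_continuous cs csR H (fun r => r)) => //.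
exact: (family_cont _ _ (tree_op_family csR csL vertex_op_family t0 T)).
Qed.

(** The projection in the factor of the root completes the left operator: $W_{T_1}(s)\,\imath
    PH(s)=\imath\,\Omega_{T_1}(s)H(s)$. Parts (b) and (c) both follow, as [Omega] at [Leaf] is
    [P]. *)
Lemma Omega_node_nonleaf T1 T2 t x : T1 <> Leaf ->
  Omega cs H P (Node T1 T2) t t0 x
  = cs Ci (RInt (fun s => Omega cs H P T1 s t0 (H s (Omega cs H P T2 s t0 x))) t0 t).
Proof.
move=> HT1; rewrite Omega_tree_op /= -RInt_bounded_linear.
- apply: RInt_ext => s _; rewrite !Omega_tree_op.
  have -> : nonleaf T1 by case: (T1) HT1.
  by rewrite /= (family_cs _ _ (tree_op_family csR csL vertex_op_family t0 T1)).
- exact: csL.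
move=> s.
have HW := tree_op_family csR csL vertex_op_family t0.
apply: (@continuous_ext _ _ (fun s =>
  tree_op vertex_op t0 T1 s (P (H s (tree_op vertex_op t0 T2 s (P x)))))).
  by move=> r; rewrite !Omega_tree_op.
apply: (family_continuous cs csR _ (fun r => r)) => //.
apply: (family_continuous cs csR (fun _ => P) (fun r => r)).
- exact: family_of_bounded_op.
- exact: continuous_id.
apply: (family_continuous cs csR H (fun r => r)) => //.
exact: (family_cont _ _ (HW T2)).
Qed.
End Omega.

End TreeExpansion.

Theorem theorem2
  (V : CompleteNormedModule R_AbsRing) (cs : C -> V -> V) (ip : V -> V -> C)
  (HV : is_complex_hilbert cs ip)
  (H : R -> V -> V)
  (HH : forall t : R, bounded_self_adjoint cs ip (H t))
  (Hcont : strongly_continuous H)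
  (P : V -> V) (HP : orth_projection cs ip P)
  (t0 : R) (T1 T2 : tree)
  (Hsize : (1 < tsize (Node T1 T2))%nat) :
  (T1 = Leaf ->
     forall (t : R) (x : V),
       Omega cs H P (Node T1 T2) t t0 x =
       cs (Copp Ci) (RInt (fun s => Qop P (H s (Omega cs H P T2 s t0 x))) t0 t)) /\
  (T2 = Leaf ->
     forall (t : R) (x : V),
       Omega cs H P (Node T1 T2) t t0 x =
       cs Ci (RInt (fun s => Omega cs H P T1 s t0 (H s (P x))) t0 t)) /\
  (T1 <> Leaf -> T2 <> Leaf ->
     forall (t : R) (x : V),
       Omega cs H P (Node T1 T2) t t0 x =
       cs Ci (RInt (fun s => Omega cs H P T1 s t0 (H s (Omega cs H P T2 s t0 x))) t0 t)).
Proof.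
assert (HHf : TreeExpansion.operator_family cs H).
{ apply TreeExpansion.family_of_strongly_continuous;
    [exact (TreeExpansion.hilbert_cs_real HV)| |exact Hcont].
  intros s. apply HH. }
assert (HPb : bounded_op cs P) by apply HP.
split; [|split].
- intros -> t x. exact (TreeExpansion.Omega_node_leaf HV HHf HPb t0 T2 t x).
- intros -> t x. apply (TreeExpansion.Omega_node_nonleaf HV HHf HPb).
  (* If both subtrees were empty, the tree would have a single vertex. *)
  intros ->. simpl in Hsize. lia.
- intros HT1 _ t x. exact (TreeExpansion.Omega_node_nonleaf HV HHf HPb t0 T2 t x HT1).
Qed.
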